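(* Let $n\ge 3$. The symmetry group $G<\mathsf{O}(2)\times S_n\times\widehat{\mathsf{S}^1}$ of any planar $n$-body choreography is either that of a circular choreography, $D(n,\infty/\ell)$, or is conjugate to one of the symmetry groups $C(n,k/\ell)$, $D(n,k/\ell)$ (with $k\geq 1$, $\ell\ge1$, $\gcd(k,\ell)=1$) and, if $n$ is odd, $C'(n,2)$, $D'(n,1)$ and $D'(n,2)$.
   Context: Identify the plane with $\mathbb{C}$. Let $X^{(n)}=\{(z_1,\dots,z_n)\in\mathbb{C}^n : \sum_j z_j=0,\ z_i\ne z_j \ \forall i\neq j\}$ and $\mathbb{T}=\mathbb{R}/\mathbb{Z}$. The group $\Gamma=\mathsf{O}(2)\times S_n$ acts on $X^{(n)}$ by $(A,\sigma)\cdot(z_1,\dots,z_n)=(Az_{\sigma^{-1}(1)},\dots,Az_{\sigma^{-1}(n)})$. Let $\widehat{\mathsf{S}^1}\cong\mathsf{O}(2)$ be the group of rotations and reflections of $\mathbb{T}$: $\theta\in\mathbb{R}/\mathbb{Z}$ denotes $t\mapsto t+\theta$ and $\overline{\theta}$ denotes $t\mapsto\theta-t$. The group $\Gamma\times\widehat{\mathsf{S}^1}$ acts on the space $\Lambda X^{(n)}$ of continuous loops $u:\mathbb{T}\to X^{(n)}$ by $((A,\sigma,\tau)\cdot u)(t)=(A,\sigma)\cdot u(\tau^{-1}(t))$. The symmetry group of $u$ is its isotropy subgroup for this action; conjugacy means conjugacy in $\Gamma\times\widehat{\mathsf{S}^1}$. Notation: $R_\theta$ is rotation of the plane by $\theta$,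 $\kappa$ is complex conjugation, $I$ is the identity of $\mathsf{O}(2)$, $e\in S_n$ the identity, $\sigma_1=(1\;2\;\cdots\;n)$, $s_1\in S_n$ is $s_1(j)=2-j \bmod n$; for $n$ odd, $\sigma_2=\sigma_1^{(n+1)/2}$ (so $\sigma_2^2=\sigma_1$). Let $\mathfrak{c}=(I,\sigma_1,-\tfrac1n)$. A (planar $n$-body) choreography is a loop $u=(z_1,\dots,z_n)\in\Lambda X^{(n)}$ fixed by $\mathfrak{c}$, i.e. $z_{j+1}(t)=z_j(t+\tfrac1n)$ for all $j$ (indices mod $n$). Groups: - $C(n,k/\ell)$ ($k,\ell\ge1$ coprime): generated by $\mathfrak{c}$ and $(R_{2\pi\ell/k},e,\tfrac1k)$. - $D(n,k/\ell)$: generated by $C(n,k/\ell)$ and $(\kappa,s_1,\overline{0})$. - $D(n,\infty/\ell)$ ($\ell$ an integer coprime to $n$): the symmetry group of the circular choreography $z_j(t)=e^{2\pi i\ell j/n}e^{2\pi i\ell t}$; up to conjugacy it is generated by $\mathfrak{c}$, all $(R_{2\pi\ell\theta},e,\theta)$ with $\theta\in\mathbb{R}/\mathbb{Z}$, and $(\kappa,s_1,\overline{0})$. - For $n$ odd: $C'(n,2)$ is generated by $(\kappa,\sigma_2,-\tfrac1{2n})$; $D'(n,1)$ is generated by $\mathfrak{c}$ and $(R_\pi,s_1,\overline{0})$; $D'(n,2)$ is generated by $(\kappa,\sigma_2,-\tfrac1{2n})$ and $(R_\pi,s_1,\overline{0})$.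
   Formalization: The choreography is additionally assumed to have least period 1 or to be circular (the statement fails, e.g., for a three-body ellipse traversed twice), and the case of a circular choreography, D(n,∞/ℓ), is stated up to conjugacy. *)

(* Defs.v *)
From HB Require Import structures.
From mathcomp Require Import all_boot all_order all_algebra perm.
From mathcomp Require Import ring_quotient complex ring zify.
From mathcomp Require Import all_classical all_reals all_analysis.

Set Implicit Arguments.
Unset Strict Implicit.
Unset Printing Implicit Defensive.

Import Order.TTheory GRing.Theory Num.Theory.
Import numFieldNormedType.Exports.

Local Open Scope classical_set_scope.
Local Open Scope ring_scope.
Local Open Scope complex_scope.

(** * Subgroups of a possibly infinite group *)

Section Subgroups.
Variable gT : groupType.
Implicit Types S G H : set gT.

Definition is_subgroup H : Prop :=
  [/\ H 1%g, (forall x y, H x -> H y -> H (x * y)%g)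
    & (forall x, H x -> H (x^-1)%g)].

Definition gen S : set gT := smallest is_subgroup S.

Definition conjugate G H : Prop :=
  exists g : gT, G = [set (h ^ g)%g | h in H].

End Subgroups.

(** * The circle R/Z and its isometry group *)

Definition circle (R : realType) : Type :=
  Quotient.quot (Num.int_num_subdef : {pred R}).

HB.instance Definition _ (R : realType) := Topological.copy (circle R)
  (quotient_topology (Quotient.quot (Num.int_num_subdef : {pred R}))).
HB.instance Definition _ (R : realType) := ZmodQuotient.copy (circle R)
  (Quotient.quot (Num.int_num_subdef : {pred R})).

Definition toT (R : realType) (x : R) : circle R := \pi_(circle R)%qT x.

Lemma toT_eq (R : realType) (x y : R) :
  toT x = toT y <-> exists m : int, x - y = m%:~R.
Proof.
have e := @Quotient.idealrBE R (Num.int_num_subdef : {pred R}) x y.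
split=> [xy|/Num.Theory.intrP xy]; last exact: (eqP (etrans (esym e) xy)).
by apply/Num.Theory.intrP; refine (etrans e _); apply/eqP; exact: xy.
Qed.

Lemma toTD (R : realType) (x y : R) : toT (x + y) = toT x + toT y.
Proof. exact: raddfD. Qed.

Lemma toTN (R : realType) (x : R) : toT (- x) = - toT x.
Proof. exact: raddfN. Qed.

(* [Rot a] is t |-> t + a and [Refl a] is t |-> a - t. *)
Inductive S1hat (R : realType) : Type := Rot of circle R | Refl of circle R.

Section S1hatGroup.
Variable R : realType.
Implicit Types a b c : S1hat R.

Definition S1hat_code a : circle R + circle R :=
  match a with Rot x => inl x | Refl x => inr x end.
Definition S1hat_decode (s : circle R + circle R) : S1hat R :=
  match s with inl x => Rot x | inr x => Refl x end.
Lemma S1hat_codeK : cancel S1hat_code S1hat_decode. Proof. by case. Qed.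

HB.instance Definition _ := Choice.copy (S1hat R) (can_type S1hat_codeK).

Definition S1hat_act a (t : circle R) : circle R :=
  match a with Rot x => t + x | Refl x => x - t end.

Definition S1hat_mul a b : S1hat R :=
  match a, b with
  | Rot x, Rot y => Rot (x + y)
  | Rot x, Refl y => Refl (x + y)
  | Refl x, Rot y => Refl (x - y)
  | Refl x, Refl y => Rot (x - y)
  end.

Definition S1hat_inv a : S1hat R :=
  match a with Rot x => Rot (- x) | Refl x => Refl x end.

Lemma S1hat_mulA : associative S1hat_mul.
Proof.
by move=> [x|x] [y|y] [z|z] /=; congr (_ _); rewrite ?opprD ?opprK ?addrA.
Qed.

Lemma S1hat_mul1 : left_id (Rot 0) S1hat_mul.
Proof. by move=> [x|x] /=; rewrite add0r. Qed.

Lemma S1hat_1mul : right_id (Rot 0) S1hat_mul.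
Proof. by move=> [x|x] /=; rewrite ?addr0 ?subr0. Qed.

Lemma S1hat_mulV : left_inverse (Rot 0) S1hat_inv S1hat_mul.
Proof. by move=> [x|x] /=; rewrite ?addNr ?subrr. Qed.

Lemma S1hat_Vmul : right_inverse (Rot 0) S1hat_inv S1hat_mul.
Proof. by move=> [x|x] /=; rewrite subrr. Qed.

HB.instance Definition _ := isGroup.Build (S1hat R)
  S1hat_mulA S1hat_mul1 S1hat_1mul S1hat_mulV S1hat_Vmul.

Lemma S1hat_act1 t : S1hat_act 1%g t = t.
Proof. exact: addr0. Qed.

Lemma S1hat_actM a b t : S1hat_act (a * b)%g t = S1hat_act a (S1hat_act b t).
Proof.
case: a b => [x|x] [y|y] /=.
- by rewrite [x + y]addrC addrA.
- by rewrite -addrA addrC.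
- by rewrite opprD [- t - y]addrC addrA.
- by rewrite opprB addrCA addrC.
Qed.

End S1hatGroup.

(** * The orthogonal group O(2) and its action on C *)

Lemma sum2E (V : nmodType) (F : 'I_2 -> V) : \sum_i F i = F 0 + F 1.
Proof.
by rewrite !big_ord_recl big_ord0 addr0; congr (_ + F _); apply: val_inj.
Qed.

Lemma ord2P (i : 'I_2) : (i == 0) || (i == 1).
Proof. by case: i => [[|[|]]]. Qed.

Definition O2 (R : realType) := {A : 'M[R]_2 | A *m A^T == 1%:M}.

Section O2Group.
Variable R : realType.
Implicit Types A B : O2 R.

HB.instance Definition _ := Choice.on (O2 R).

Lemma O2_mul_subproof A B :
  (val A *m val B) *m (val A *m val B)^T == 1%:M.
Proof.
rewrite trmx_mul mulmxA -(mulmxA (val A)) (eqP (valP B)) mulmx1.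
exact: (valP A).
Qed.
Definition O2_mul A B : O2 R := exist _ (val A *m val B) (O2_mul_subproof A B).

Lemma O2_one_subproof : 1%:M *m (1%:M)^T == 1%:M :> 'M[R]_2.
Proof. by rewrite trmx1 mulmx1. Qed.
Definition O2_one : O2 R := exist _ 1%:M O2_one_subproof.

Lemma O2_inv_subproof A : (val A)^T *m (val A)^T^T == 1%:M.
Proof. by rewrite trmxK; apply/eqP/mulmx1C/eqP/(valP A). Qed.
Definition O2_inv A : O2 R := exist _ (val A)^T%R (O2_inv_subproof A).

Lemma O2_mulA : associative O2_mul.
Proof. by move=> A B C; apply: val_inj; exact: mulmxA. Qed.

Lemma O2_mul1 : left_id O2_one O2_mul.
Proof. by move=> A; apply: val_inj; exact: mul1mx. Qed.

Lemma O2_1mul : right_id O2_one O2_mul.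
Proof. by move=> A; apply: val_inj; exact: mulmx1. Qed.

Lemma O2_mulV : left_inverse O2_one O2_inv O2_mul.
Proof. by move=> A; apply: val_inj; apply/mulmx1C/eqP/(valP A). Qed.

Lemma O2_Vmul : right_inverse O2_one O2_inv O2_mul.
Proof. by move=> A; apply: val_inj; apply/eqP/(valP A). Qed.

HB.instance Definition _ := isGroup.Build (O2 R)
  O2_mulA O2_mul1 O2_1mul O2_mulV O2_Vmul.

Definition O2_act A (z : R[i]) : R[i] :=
  (val A 0 0 * complex.Re z + val A 0 1 * complex.Im z) +i*
  (val A 1 0 * complex.Re z + val A 1 1 * complex.Im z).

Lemma O2_act1 z : O2_act 1%g z = z.
Proof.
by case: z => x y; rewrite /O2_act !mxE /= !mul1r !mul0r add0r addr0.
Qed.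

Lemma O2_actM A B z : O2_act (A * B)%g z = O2_act A (O2_act B z).
Proof.
case: z => x y; rewrite /O2_act !mxE !sum2E /=.
congr (_ +i* _); ring.
Qed.

End O2Group.

Section PlaneIsometries.
Variable R : realType.

Definition rot_mx (x : R) : 'M[R]_2 := \matrix_(i, j)
  if i == j then cos x else if i == 0 then - sin x else sin x.

Lemma rot_mx_subproof x : rot_mx x *m (rot_mx x)^T == 1%:M.
Proof.
apply/eqP/matrixP => i j; rewrite !mxE sum2E !mxE /=.
have cs := cos2Dsin2 x.
case/orP: (ord2P i) => /eqP ->; case/orP: (ord2P j) => /eqP -> /=; rewrite -?cs ?mulr0n; ring.
Qed.

(* Rotation of the plane by the angle x, in radians. *)
Definition plane_rot x : O2 R := exist _ (rot_mx x) (rot_mx_subproof x).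

Definition kappa_mx : 'M[R]_2 := \matrix_(i, j)
  if i == j then (if i == 0 then 1 else - 1) else 0.

Lemma kappa_mx_subproof : kappa_mx *m kappa_mx^T == 1%:M.
Proof.
apply/eqP/matrixP => i j; rewrite !mxE sum2E !mxE /=.
case/orP: (ord2P i) => /eqP ->; case/orP: (ord2P j) => /eqP -> /=; ring.
Qed.

Definition kappa : O2 R := exist _ kappa_mx kappa_mx_subproof.

Lemma kappaE z : O2_act kappa z = z^*.
Proof.
by case: z => x y; rewrite /O2_act !mxE /= !mul0r addr0 add0r mul1r mulN1r.
Qed.

Definition cis (x : R) : R[i] := cos x +i* sin x.

Lemma plane_rotE x z : O2_act (plane_rot x) z = cis x * z.
Proof.
case: z => a b; rewrite /O2_act !mxE /=; apply/eqP; rewrite eq_complex /=.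
by apply/andP; split; apply/eqP; ring.
Qed.

Lemma cisDZ x (m : int) : cis (2 * pi * (x + m%:~R)) = cis (2 * pi * x).
Proof.
have periodN k y : cis (2 * pi * (y + k%:R)) = cis (2 * pi * y).
  elim: k => [|k IHk]; first by rewrite addr0.
  have -> : 2 * pi * (y + k.+1%:R) = 2 * pi * (y + k%:R) + pi *+ 2 :> R.
    by rewrite -natr1; ring.
  by rewrite -IHk /cis cosD2pi sinD2pi.
case: m => k; first exact: periodN.
by rewrite NegzE mulrNz -(periodN k.+1) pmulrn subrK.
Qed.

End PlaneIsometries.

(** * The symmetric group, with composition of maps as product *)

(* MathComp multiplies permutations in the opposite order. *)
Definition Sn (n : nat) : Type := {perm 'I_n}.

Section SnGroup.
Variable n : nat.
Implicit Types s t : {perm 'I_n}.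

HB.instance Definition _ := Choice.on (Sn n).

Definition Sn_mul (s t : Sn n) : Sn n := ((t : {perm 'I_n}) * s)%g.
Definition Sn_inv (s : Sn n) : Sn n := ((s : {perm 'I_n})^-1)%g.

Lemma Sn_mulA : associative Sn_mul.
Proof. by move=> s t r; rewrite /Sn_mul mulgA. Qed.

Lemma Sn_mul1 : left_id (1%g : {perm 'I_n}) Sn_mul.
Proof. exact: mulg1. Qed.

Lemma Sn_1mul : right_id (1%g : {perm 'I_n}) Sn_mul.
Proof. exact: mul1g. Qed.

Lemma Sn_mulV : left_inverse (1%g : {perm 'I_n}) Sn_inv Sn_mul.
Proof. exact: mulgV. Qed.

Lemma Sn_Vmul : right_inverse (1%g : {perm 'I_n}) Sn_inv Sn_mul.
Proof. exact: mulVg. Qed.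

HB.instance Definition _ := isGroup.Build (Sn n)
  Sn_mulA Sn_mul1 Sn_1mul Sn_mulV Sn_Vmul.

Definition Sn_act (s : Sn n) : 'I_n -> 'I_n := (s : {perm 'I_n}).

Lemma Sn_actM (s t : Sn n) j : Sn_act (s * t)%g j = Sn_act s (Sn_act t j).
Proof. exact: permM. Qed.

(* The bodies 1, ..., n are indexed by their residues mod n, so that the
   element 0 of 'I_n stands for the body n. *)
Definition sigma1 : Sn n := perm (@ordS_inj n).

Lemma s1_subproof (j : 'I_n) : ((n + 2 - j) %% n < n)%N.
Proof. by rewrite ltn_mod; apply: leq_ltn_trans (ltn_ord j). Qed.

Definition s1_fun (j : 'I_n) : 'I_n := Ordinal (s1_subproof j).

Lemma s1_funK : involutive s1_fun.
Proof.
move=> j; apply: val_inj => /=; have jn := ltn_ord j.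
have e : (n + 2 - (n + 2 - j) %% n = (n + 2 - j) %/ n * n + j)%N.
  by have := divn_eq (n + 2 - j) n; have := ltn_pmod (n + 2 - j) (leq_ltn_trans (leq0n _) jn); lia.
by rewrite e modnMDl modn_small.
Qed.

Definition s1 : Sn n := perm (inv_inj s1_funK).

Definition sigma2 : Sn n := (sigma1 ^+ (n.+1)./2)%g.

Lemma sigma1_exp k (j : 'I_n) : Sn_act (sigma1 ^+ k)%g j = ((j + k) %% n)%N :> nat.
Proof.
elim: k j => [|k IHk] j; first by rewrite [LHS](congr1 val (perm1 j)) addn0 modn_small.
by rewrite expgSr Sn_actM IHk /Sn_act permE /= modnDml addSnnS.
Qed.

Lemma sigma2_sqr : odd n -> (sigma2 * sigma2 = sigma1)%g.
Proof.
move=> no; rewrite /sigma2 -expgnDr addnn halfK /= no subn0.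
apply/permP => j; apply: val_inj.
apply: (etrans (sigma1_exp n.+1 j)).
by rewrite permE /= addnS -addSn modnDr.
Qed.

Lemma s1E (j : 'I_n) : (Sn_act s1 j + j = 2 %[mod n])%N.
Proof.
have jn := ltn_ord j.
by rewrite /Sn_act permE /= modnDml subnK ?modnDl // ltnW // ltn_addr.
Qed.

End SnGroup.

(** * Loops of configurations and their symmetry groups *)

HB.instance Definition _ (R : realType) := NormedModule.copy R[i] (R[i])^o.

Section Loops.
Variables (R : realType) (n : nat).

Definition sym : Type := (O2 R * Sn n * S1hat R)%type.
HB.instance Definition _ := Group.on sym.

Definition config : set 'rV[R[i]]_n :=
  [set z | \sum_j z 0 j = 0 /\ forall i j, i != j -> z 0 i != z 0 j].

Definition config_act (A : O2 R) (s : Sn n) (z : 'rV[R[i]]_n) :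
  'rV[R[i]]_n := \row_j O2_act A (z 0 (Sn_act s^-1%g j)).

Definition loop : Type := circle R -> 'rV[R[i]]_n.

Definition loop_act (g : sym) (u : loop) : loop :=
  let: (A, s, tau) := g in
  fun t => config_act A s (u (S1hat_act tau^-1%g t)).

Lemma loop_act1 u : loop_act 1%g u = u.
Proof.
have id1 : Sn_act (1%g : Sn n) =1 id by move=> j; exact: perm1.
apply/funext => t; apply/rowP => j.
by rewrite [LHS]mxE O2_act1 !invg1 S1hat_act1 id1.
Qed.

Lemma loop_actM g h u : loop_act (g * h)%g u = loop_act g (loop_act h u).
Proof.
case: g h => [[A s] a] [[B r] b]; apply/funext => t /=; apply/rowP => j.
by rewrite !mxE O2_actM !invgM Sn_actM S1hat_actM.
Qed.

Definition LambdaX : set loop :=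
  [set u | continuous u /\ forall t, config (u t)].

Definition symmetry_group (u : loop) : set sym := [set g | loop_act g u = u].

Definition chor : sym := (1%g, sigma1 n, Rot (toT (- n%:R^-1))).

Definition choreography (u : loop) : Prop :=
  LambdaX u /\ loop_act chor u = u.

Lemma chor_fixedP (u : loop) : loop_act chor u = u <->
  forall t j, u t 0 (ordS j) = u (t + toT (n%:R^-1)) 0 j.
Proof.
have E t j : loop_act chor u t 0 (ordS j) = u (t + toT (n%:R^-1)) 0 j.
  rewrite /= mxE O2_act1 /= toTN opprK.
  have -> : ordS j = Sn_act (sigma1 n) j by rewrite /Sn_act permE.
  by rewrite -Sn_actM mulVg /Sn_act perm1.
split=> [uE t j|uE]; first by rewrite -E uE.
apply/funext => t; apply/rowP => j.
by rewrite -(ord_predK j) E uE.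
Qed.

(** * The groups of the classification *)

Definition C_group (k l : nat) : set sym :=
  gen [set chor; (plane_rot (2 * pi * (l%:R / k%:R)), 1%g, Rot (toT k%:R^-1))].

Definition D_group (k l : nat) : set sym :=
  gen (C_group k l `|` [set (kappa R, s1 n, Refl (toT 0))]).

(* The value does not depend on the representative of t since l is an integer:
   see [circularE]. *)
Definition circular (l : int) : loop := fun t => \row_j
  (cis (2 * pi * (l%:~R * j%:R / n%:R)) * cis (2 * pi * (l%:~R * repr t))).

Lemma circularE l x j : circular l (toT x) 0 j =
  cis (2 * pi * (l%:~R * j%:R / n%:R)) * cis (2 * pi * (l%:~R * x)).
Proof.
rewrite mxE; congr (_ * _).
have /toT_eq[m xm] : toT (repr (toT x)) = toT x by exact: reprK.
have -> : repr (toT x) = x + m%:~R by rewrite -xm addrC subrK.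
by rewrite [l%:~R * (_ + _)]mulrDr -intrM cisDZ.
Qed.

Definition Dinf_group (l : int) : set sym := symmetry_group (circular l).

Definition C'2_group : set sym :=
  gen [set (kappa R, sigma2 n, Rot (toT (- (2 * n%:R)^-1)))].

Definition D'1_group : set sym :=
  gen [set chor; (plane_rot pi, s1 n, Refl (toT 0))].

Definition D'2_group : set sym :=
  gen [set (kappa R, sigma2 n, Rot (toT (- (2 * n%:R)^-1)));
           (plane_rot pi, s1 n, Refl (toT 0))].

(** * The period *)

(* A loop that runs m > 1 times through a loop of period 1/m is fixed by
   (I, e, 1/m).  No group C(n,k/l), D(n,k/l), C'(n,2), D'(n,1), D'(n,2) contains
   a nontrivial pure time shift, so for such a loop the classification can only
   hold if the motion is circular. *)
Definition least_period_one (u : loop) : Prop :=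
  forall a, (forall t, u (t + a) = u t) -> a = 0.

(* The circular choreographies of any radius and phase. *)
Definition is_circular (u : loop) : Prop :=
  exists (c : R[i]) (l : int), forall t, u t = c *: circular l t.

End Loops.

Arguments circular : clear implicits.
Arguments C_group : clear implicits.
Arguments D_group : clear implicits.
Arguments Dinf_group : clear implicits.
Arguments C'2_group : clear implicits.
Arguments D'1_group : clear implicits.
Arguments D'2_group : clear implicits.

(* Main.v *)
(**
A choreography is determined by the curve [q] of its first body, the other
bodies being the translates [q (t + j / n)].  Since bodies do not collide, a
symmetry permutes them as the dihedral action on [Z/n] does, so up to the
generator [chor] it is a pair (plane isometry [A], rotation or reflection [tau]
of the circle) with [A \o q = q \o tau].  Such an [A] and [tau] determine each
other: a pure reversal of time produces a collision, a pure time shift is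
excluded by the least period, and a curve on a line through the origin collides
with its translate by [1/n].  The times of the pure rotations form a subgroup of
[R] containing 1.  If it is dense, the squares of its elements act on [q] by plane
rotations, and by continuity [q (t + x) q 0 = q x q t] for all [x], so that
[q / q 0] is a character and the motion is circular.  Otherwise it is generated
by [1/k], and the group is generated by [chor], one element over [1/k] and at
most one time-reversing element; their relations in O(2) leave five families.
*)
Require Import Defs.
From mathcomp Require Import all_boot all_order all_algebra perm.
From mathcomp Require Import ring_quotient complex ring lra zify.
From mathcomp Require Import all_classical all_reals all_analysis.

Set Implicit Arguments.
Unset Strict Implicit.
Unset Printing Implicit Defensive.

Import Order.TTheory GRing.Theory Num.Theory.
Import numFieldNormedType.Exports.

Local Open Scope classical_set_scope.
Local Open Scope ring_scope.
Local Open Scope complex_scope.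

(** * Generated subgroups and the group O(2) *)

Section Generated.
Variable gT : groupType.
Implicit Types (S T G H : set gT) (g x y : gT).

Lemma gen_is_subgroup S : is_subgroup (gen S).
Proof.
split=> [H [[]]//|x y Sx Sy H HH|x Sx H HH]; have [[_ HM HV] _] := HH.
- exact: HM (Sx H HH) (Sy H HH).
- exact: HV (Sx H HH).
Qed.

Lemma sub_gen S : S `<=` gen S.
Proof. exact: sub_gen_smallest. Qed.

Lemma gen_sub S H : is_subgroup H -> S `<=` H -> gen S `<=` H.
Proof. exact: smallest_sub. Qed.

Lemma subgroupX G x k : is_subgroup G -> G x -> G (x ^+ k)%g.
Proof.
move=> [G1 GM _] Gx; elim: k => [|k IHk]; first by rewrite expg0.
by rewrite expgS; exact: GM.
Qed.

Lemma subgroup_preimJ G g : is_subgroup G -> is_subgroup [set x | G (x ^ g)%g].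
Proof.
move=> [G1 GM GV]; split=> [|x y Gx Gy|x Gx] /=.
- by rewrite conj1g.
- by rewrite conjMg; exact: GM.
- by rewrite conjVg; exact: GV.
Qed.

(** The preimage of a subgroup under conjugation is a subgroup, so both inclusions need checking on
    generators only. *)
Lemma conjugate_gen S T g :
  (forall x, S x -> gen T (x ^ g)%g) -> (forall y, T y -> gen S (y ^ g^-1)%g) ->
  conjugate (gen T) (gen S).
Proof.
move=> ST TS; exists g; apply/seteqP; split=> [y Ty|_ [x Sx <-]].
- exists (y ^ g^-1)%g; last exact: conjgKV.
  exact: (gen_sub (subgroup_preimJ g^-1 (gen_is_subgroup S)) TS Ty).
- exact: (gen_sub (subgroup_preimJ g (gen_is_subgroup T)) ST Sx).
Qed.

Lemma eq_gen S T : S `<=` gen T -> T `<=` gen S -> gen S = gen T.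
Proof.
by move=> ST TS; apply/seteqP; split; apply: gen_sub => //; exact: gen_is_subgroup.
Qed.

End Generated.

Section O2Facts.
Variable R : realType.
Implicit Types (A B : O2 R) (x y : R) (z : R[i]).

Lemma plane_rotD x y : plane_rot (x + y) = (plane_rot x * plane_rot y)%g.
Proof.
apply: val_inj; apply/matrixP => i j; rewrite !mxE sum2E !mxE.
case/orP: (ord2P i) => /eqP ->; case/orP: (ord2P j) => /eqP -> /=;
  rewrite ?cosD ?sinD; ring.
Qed.

Lemma plane_rot0 : plane_rot 0 = 1%g :> O2 R.
Proof.
apply: val_inj; apply/matrixP => i j; rewrite !mxE cos0 sin0 oppr0.
by case/orP: (ord2P i) => /eqP ->; case/orP: (ord2P j) => /eqP ->.
Qed.

Lemma plane_rotN x : plane_rot (- x) = (plane_rot x)^-1%g.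
Proof.
by apply/eqP; rewrite -mulg_eq1 -plane_rotD addNr plane_rot0.
Qed.

Lemma plane_rotX x k : plane_rot (k%:R * x) = (plane_rot x ^+ k)%g.
Proof.
elim: k => [|k IHk]; first by rewrite mul0r plane_rot0 expg0.
by rewrite expgS -IHk -plane_rotD -natr1 mulrDl mul1r addrC.
Qed.

Lemma plane_rotC x y : commute (plane_rot x) (plane_rot y).
Proof. by rewrite /commute -!plane_rotD addrC. Qed.

Lemma kappa_rot x : (kappa R * plane_rot x = plane_rot (- x) * kappa R)%g.
Proof.
apply: val_inj; apply/matrixP => i j; rewrite !mxE !sum2E !mxE cosN sinN.
case/orP: (ord2P i) => /eqP ->; case/orP: (ord2P j) => /eqP -> /=; ring.
Qed.

Lemma kappa_sqr : (kappa R * kappa R = 1)%g.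
Proof.
apply: val_inj; apply/matrixP => i j; rewrite !mxE !sum2E !mxE.
case/orP: (ord2P i) => /eqP ->; case/orP: (ord2P j) => /eqP -> /=; ring.
Qed.

(** The bound on the angle puts its half where the cosine is nonnegative, which fixes the sign of a
    square root in [continuous_character]. *)
Lemma unit_circle_angle x y : x ^+ 2 + y ^+ 2 = 1 ->
  exists2 a, x = cos a /\ y = sin a & `|a| <= pi.
Proof.
move=> xy1; have x2 : x ^+ 2 <= 1 by rewrite -xy1 lerDl sqr_ge0.
have x1 : -1 <= x <= 1 by rewrite -ler_norml -(@expr_le1 _ 2) // real_normK // num_real.
have cx : cos (acos x) = x by apply: acosK; rewrite in_itv.
have sx : sin (acos x) = `|y|.
  by rewrite sin_acos // -xy1 [x ^+ 2 + _]addrC addrK sqrtr_sqr.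
have [y0|y0] := leP 0 y.
  by exists (acos x); rewrite ?cx ?sx ger0_norm ?acos_ge0 ?acos_lepi.
exists (- acos x); first by rewrite cosN sinN cx sx ltr0_norm // opprK.
by rewrite normrN ger0_norm ?acos_ge0 ?acos_lepi.
Qed.

Lemma O2_unit A i : val A i 0 ^+ 2 + val A i 1 ^+ 2 = 1.
Proof.
have /eqP/matrixP/(_ i i) := valP A.
by rewrite !mxE sum2E !mxE eqxx -!expr2.
Qed.

Lemma O2P A : (exists a, A = plane_rot a) \/
  (exists a, A = (plane_rot a * kappa R * plane_rot (- a))%g).
Proof.
have [a [ca sa] _] := unit_circle_angle (O2_unit A 0).
have r1 := O2_unit A 1.
have r01 : val A 0 0 * val A 1 0 + val A 0 1 * val A 1 1 = 0.
  have /eqP/matrixP/(_ 0 1) := valP A.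
  by rewrite !mxE sum2E !mxE.
rewrite ca sa in r01.
have cs := cos2Dsin2 a.
set p := val A 1 0 in r1 r01; set q := val A 1 1 in r1 r01.
have pE : p = - sin a * (cos a * q - sin a * p).
  have -> : - sin a * (cos a * q - sin a * p) = sin a ^+ 2 * p - cos a * (sin a * q) by ring.
  have -> : sin a * q = - (cos a * p) by apply/eqP; rewrite -addr_eq0 addrC r01.
  rewrite -[LHS]mul1r -cs; ring.
have qE : q = cos a * (cos a * q - sin a * p).
  have -> : cos a * (cos a * q - sin a * p) = cos a ^+ 2 * q - sin a * (cos a * p) by ring.
  have -> : cos a * p = - (sin a * q) by apply/eqP; rewrite -addr_eq0 r01.
  rewrite -[LHS]mul1r -cs; ring.
set d := cos a * q - sin a * p in pE qE.
have : d ^+ 2 = 1.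
  have -> : d ^+ 2 = (sin a ^+ 2 + cos a ^+ 2) * d ^+ 2 by rewrite addrC cs mul1r.
  by rewrite -r1 [in RHS]pE [in RHS]qE; ring.
move/eqP; rewrite sqrf_eq1 => /orP[/eqP d1|/eqP d1]; rewrite d1 in pE qE.
- left; exists (- a); apply: val_inj; apply/matrixP => i j; rewrite !mxE cosN sinN.
  case/orP: (ord2P i) => /eqP ->; case/orP: (ord2P j) => /eqP -> /=;
  rewrite ?ca ?sa -?/p -?/q ?pE ?qE; ring.
(* A reflection with first row (cos a, sin a) has its axis at the angle a / 2. *)
- right; exists (a / 2); rewrite -mulgA kappa_rot opprK mulgA -plane_rotD.
  have -> : a / 2 + a / 2 = a by field.
  apply: val_inj; apply/matrixP => i j; rewrite !mxE sum2E !mxE.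
  case/orP: (ord2P i) => /eqP ->; case/orP: (ord2P j) => /eqP -> /=;
  rewrite ?ca ?sa -?/p -?/q ?pE ?qE; ring.
Qed.

Lemma plane_rotDZ x (m : int) :
  plane_rot (2 * pi * (x + m%:~R)) = plane_rot (2 * pi * x).
Proof.
have := cisDZ x m; rewrite /cis => -[ec es].
by apply: val_inj; apply/matrixP => i j; rewrite !mxE ec es.
Qed.

(** After removal of whole turns the angle is 2 pi f with 0 <= f < 1. If its cosine is 1, then sin
    (pi f) = 0, which is impossible for f > 0. *)
Lemma plane_rot_eq1 x : plane_rot x = 1%g -> exists m : int, x = 2 * pi * m%:~R.
Proof.
have pi0 := pi_gt0 R.
have := floorD1_gt (x / (2 * pi)); have := floor_le (x / (2 * pi)).
set m := Num.floor _; set f := x / (2 * pi) - m%:~R => mx xm.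
have -> : x = 2 * pi * (f + m%:~R) by rewrite /f subrK mulrC divfK ?mulf_neq0 ?pnatr_eq0 ?gt_eqF.
rewrite plane_rotDZ => /(congr1 (fun A : O2 R => val A 0 0)); rewrite !mxE /= => c1.
have f0 : 0 <= f by rewrite subr_ge0.
have f1 : f < 1 by rewrite ltrBlDl; move: xm; rewrite intrD.
exists m; congr (_ * _); suff -> : f = 0 by rewrite add0r.
apply/eqP; rewrite eq_le f0 andbT leNgt; apply/negP => f_gt0.
have : 0 < sin (pi * f).
  by apply: sin_gt0_pi; rewrite mulr_gt0 //= -[ltRHS]mulr1 ltr_pM2l.
have -> : sin (pi * f) = 0; last by rewrite ltxx.
have := cos2Dsin2 (pi * f).
move: c1; have -> : 2 * pi * f = pi * f + pi * f by ring.
rewrite cosD -!expr2 => c1 c2; apply/eqP; rewrite -sqrf_eq0; apply/eqP.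
by move: c1 c2; rewrite -[1%:R]/(1 : R); lra.
Qed.

Lemma plane_rot_involution x : (plane_rot x * plane_rot x = 1)%g ->
  plane_rot x <> 1%g -> plane_rot x = plane_rot pi.
Proof.
rewrite -plane_rotD => /plane_rot_eq1[m xm] x1.
have xE : x = pi * m%:~R.
  by apply: (@mulfI _ 2%:R) => //; rewrite mulr_natl mulr2n xm mulrA.
have m2 := divz_eq m 2; have := @modz_ge0 m 2 isT; have := @ltz_pmod m 2 isT.
move: xE; rewrite {1}m2; case: (m %% 2)%Z => // -[|[|//]] xE _ _.
  case: x1; rewrite xE addr0 intrM.
  have -> : pi * ((m %/ 2)%Z%:~R * 2%:~R) = 2 * pi * (0 + (m %/ 2)%Z%:~R) :> R by ring.
  by rewrite plane_rotDZ mulr0 plane_rot0.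
have -> : pi = 2 * pi * 2^-1 :> R by field.
rewrite -(plane_rotDZ _ (m %/ 2)%Z) xE intrD intrM; by congr plane_rot; field.
Qed.

End O2Facts.

(** * Continuous functions and dense subgroups of the real line *)

Section RealLine.
Variable R : realType.
Implicit Types (f p X Y c s : R -> R) (H : set R) (x y a : R).

Lemma continuous_zero f x y : continuous f -> f x <= 0 -> 0 <= f y ->
  exists z, f z = 0.
Proof.
move=> cf fx fy.
have zero a b : a <= b -> Num.min (f a) (f b) <= 0 <= Num.max (f a) (f b) ->
    exists z, f z = 0.
  move=> ab mM; have [|z _ fz] := IVT ab _ mM; last by exists z.
  exact: continuous_subspaceT.
have [xy|/ltW yx] := leP x y; [apply: zero xy _|apply: zero yx _].
all: by rewrite ge_min le_max fx fy ?orbT.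
Qed.

Lemma shift_continuous f a : continuous f -> continuous (fun x => f (x + a)).
Proof.
move=> cf x; apply: (@continuous_comp _ _ _ (fun y => y + a) f); last exact: cf.
by apply: cvgD; [exact: cvg_id|exact: cvg_cst].
Qed.

Lemma antiperiodic_zero f a : continuous f -> (forall x, f (x + a) = - f x) ->
  exists z, f z = 0.
Proof.
move=> cf fa; have [f0|/ltW f0] := leP (f 0) 0.
- by apply: (@continuous_zero f 0 (0 + a)) => //; rewrite fa oppr_ge0.
- by apply: (@continuous_zero f (0 + a) 0) => //; rewrite fa oppr_le0.
Qed.

(* The increments along an orbit of the shift sum to zero over a period. *)
Lemma periodic_shift_fixed p (n : nat) : (0 < n)%N -> continuous p ->
  (forall x, p (x + 1) = p x) -> exists x, p (x + n%:R^-1) = p x.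
Proof.
move=> n0 cp p1; pose d x := p (x + n%:R^-1) - p x.
have cd : continuous d.
  by move=> x; apply: cvgB; [exact: (shift_continuous (a := n%:R^-1) cp)|exact: cp].
have sumd : \sum_(0 <= i < n) d (i%:R / n%:R) = 0.
  have := telescope_sumr (fun i => p (i%:R / n%:R)) (leq0n n).
  have := p1 0; rewrite add0r => p10.
  rewrite divff ?pnatr_eq0 -?lt0n // mul0r p10 subrr => tele.
  rewrite -[RHS]tele.
  by apply: eq_bigr => i _; rewrite /d -natr1 mulrDl mul1r.
have sum_gt0 F : (forall i, 0 < F i) -> 0 < \sum_(0 <= i < n) F i :> R.
  move=> F0; rewrite -(prednK n0) big_nat_recl //=.
  by rewrite ltr_wpDr ?F0 // sumr_ge0 // => i _; rewrite ltW.
suff [z dz] : exists z, d z = 0 by exists z; apply/eqP; rewrite -subr_eq0; apply/eqP.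
have [x dx] : exists x, d x <= 0.
  apply: contrapT => /forallNP dN; have : 0 < \sum_(0 <= i < n) d (i%:R / n%:R).
    by apply: sum_gt0 => i; rewrite ltNge; apply/negP/dN.
  by rewrite sumd ltxx.
have [y dy] : exists y, 0 <= d y.
  apply: contrapT => /forallNP dN; have : 0 < \sum_(0 <= i < n) - d (i%:R / n%:R).
    by apply: sum_gt0 => i; rewrite oppr_gt0 ltNge; apply/negP/dN.
  by rewrite sumrN sumd oppr0 ltxx.
exact: continuous_zero cd dx dy.
Qed.

Definition additive_subgroup H : Prop :=
  [/\ H 0, forall x y, H x -> H y -> H (x + y) & forall x, H x -> H (- x)].

(** For an additive subgroup this amounts to density in the line. *)
Definition arbitrarily_small H : Prop :=
  forall e, 0 < e -> exists2 d, H d & 0 < d < e.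

Lemma additive_subgroupMz H d (m : int) : additive_subgroup H -> H d -> H (m%:~R * d).
Proof.
move=> [H0 HD HN] Hd.
have HX k : H (k%:R * d).
  elim: k => [|k IHk]; first by rewrite mul0r.
  by rewrite -natr1 mulrDl mul1r; exact: HD.
by case: m => k; [exact: HX|rewrite NegzE mulrNz mulNr; exact/HN/HX].
Qed.

Lemma floor_remainder x d : 0 < d -> 0 <= x - (Num.floor (x / d))%:~R * d < d.
Proof.
move=> d0; have := floor_le (x / d); have := floorD1_gt (x / d).
rewrite ltr_pdivrMr // ler_pdivlMr // intrD mulrDl mul1r => xd dx.
by rewrite subr_ge0 dx ltrBlDl.
Qed.

(** Near any x lies a point of [H]: the largest multiple of a small element [d] that does not exceed
    x. *)
Lemma dense_zero H f : additive_subgroup H -> arbitrarily_small H ->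
  continuous f -> (forall x, H x -> f x = 0) -> forall x, f x = 0.
Proof.
move=> sH aH cf f0 x; apply/eqP/negP => /negP fx.
have fx0 : 0 < `|f x| by rewrite normr_gt0.
have /cvgrPdist_lt/(_ _ fx0) := cf x.
move=> /nbhs_ballP[e /= e0 xe].
have [d Hd /andP[d0 de]] := aH e e0.
have /andP[r0 rd] := floor_remainder x d0.
have : `|f x - f ((Num.floor (x / d))%:~R * d)| < `|f x|.
  by apply: xe; rewrite /ball /= ger0_norm // (lt_trans rd).
by rewrite (f0 (_%:~R * d)) ?subr0 ?ltxx //; exact: additive_subgroupMz.
Qed.

(** Without small positive elements, there is a least positive one and it generates [H]. As 1 is a
    multiple of it, it has the form 1 / k. *)
Lemma additive_subgroup_dichotomy H : additive_subgroup H -> H 1 ->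
  (exists k : nat, [/\ (0 < k)%N, H (k%:R^-1) &
     forall x, H x -> exists i : int, x = i%:~R / k%:R]) \/
  arbitrarily_small H.
Proof.
move=> sH H1; have [H0 HD HN] := sH.
have [|/existsNP[e /not_implyP[e0 He]]] := pselect (arbitrarily_small H); [by right|left].
have eH d : H d -> 0 < d -> e <= d.
  by move=> Hd d0; rewrite leNgt; apply/negP => de; apply: He; exists d => //; rewrite d0.
pose P := [set d | H d /\ 0 < d].
have infP : has_inf P.
  by split; [exists 1|exists e => d [Hd d0]; exact: eH].
have [d [Hd d0] de] := inf_adherent e0 infP.
have dmin h : H h -> 0 < h -> d <= h.
  move=> Hh h0; rewrite leNgt; apply/negP => hd.
  have : e <= d - h by apply: eH; [apply: (HD _ _ Hd); exact: HN|rewrite subr_gt0].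
  have : inf P <= h by apply: (ge_inf infP.2); split.
  by move: de; lra.
have Hmul x : H x -> exists i : int, x = i%:~R * d.
  move=> Hx; exists (Num.floor (x / d)).
  have /andP[r0 rd] := floor_remainder x d0.
  apply/eqP; rewrite -subr_eq0 eq_le r0 andbT leNgt; apply/negP => r_gt0.
  have : d <= x - (Num.floor (x / d))%:~R * d.
    by apply: (dmin _ _ r_gt0); apply: (HD _ _ Hx); apply: HN;
      exact: (additive_subgroupMz _ sH Hd).
  by rewrite leNgt rd.
have [k kd] := Hmul 1 H1.
have k0 : 0 < k by rewrite -(ltr0z R) -(pmulr_lgt0 _ d0) -kd.
have dk : d = k%:~R^-1.
  by apply: (@mulfI _ k%:~R); rewrite ?divff -?kd // intr_eq0 gt_eqF.
case: k k0 kd dk => // k k0 _ dk; exists k; split => //; first by rewrite -dk.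
by move=> x /Hmul[i ->]; exists i; rewrite dk.
Qed.

(* The angle of the character is halved together with its argument; the sign of
   the square root is determined because the real part is positive near 0. *)
Lemma continuous_character c s : continuous c -> continuous s ->
  (forall x y, c (x + y) = c x * c y - s x * s y) ->
  (forall x y, s (x + y) = s x * c y + c x * s y) ->
  (forall x, c x ^+ 2 + s x ^+ 2 = 1) ->
  exists a, forall x, c x = cos (a * x) /\ s x = sin (a * x).
Proof.
move=> cc cs cD sD cs1.
(* If s 0 were nonzero, s 0 = 2 s 0 c 0 would give c 0 = 1/2, and then 1/2 = 1/4 - (s 0)^2. *)
have s0 : s 0 = 0.
  have := sD 0 0; have := cD 0 0; have := cs1 0; rewrite addr0 => u1 u2 u3.
  apply: contrapT => /eqP sn0.
  have c0 : c 0 = 1/2 by apply: (mulfI sn0); lra.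
  by move: u1 u2; rewrite c0; nra.
have c0 : c 0 = 1.
  by have := cD 0 0; have := cs1 0; rewrite addr0 s0; nra.
have [e e0 ce] : exists2 e : R, 0 < e & forall x, `|x| < e -> 0 < c x.
  have /cvgrPdist_lt/(_ _ ltr01)/nbhs_ballP[e /= e0 He] := cc 0.
  exists e => // x xe; have : `|c 0 - c x| < 1 by apply: He; rewrite /ball /= sub0r normrN.
  by rewrite c0 ltr_norml => /andP[_]; lra.
have [t [ct st] tpi] : exists2 t, c (e / 2) = cos t /\ s (e / 2) = sin t & `|t| <= pi.
  exact: unit_circle_angle.
pose a := t / (e / 2).
(* The set where the two characters agree is a subgroup; it is dense once it contains e / 2 divided
   by every power of 2. *)
pose H := [set x | c x = cos (a * x) /\ s x = sin (a * x)].
have sH : additive_subgroup H.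
  split; first by rewrite /H /= mulr0 cos0 sin0.
    by move=> x y [cx sx] [cy sy]; rewrite /H /= cD sD mulrDr cosD sinD cx sx cy sy.
  move=> x [cx sx]; rewrite /H /= mulrN cosN sinN -cx -sx.
  have := cD x (- x); have := sD x (- x); have := cs1 x; rewrite subrr c0 s0 => u1 u2 u3.
  split.
    have : c x * (c x * c (- x) - s x * s (- x)) + s x * (s x * c (- x) + c x * s (- x)) = c x by rewrite -u2 -u3; ring.
    move=> <-; rewrite -[LHS]mulr1 -u1; ring.
  have : - s x * (c x * c (- x) - s x * s (- x)) + c x * (s x * c (- x) + c x * s (- x)) = - s x by rewrite -u2 -u3; ring.
  move=> <-; rewrite -[LHS]mulr1 -u1; ring.
have Hm m : H (e / 2 / 2 ^+ m).
  elim: m => [|m [IHc IHs]].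
    by rewrite /H /= expr0 divr1 /a divfK // mulf_neq0 ?invr_eq0 ?pnatr_eq0 // gt_eqF.
  set x := e / 2 / 2 ^+ m.+1.
  have xx : e / 2 / 2 ^+ m = x + x by rewrite /x exprS; field; rewrite expf_neq0.
  have cpos : 0 < c x.
    apply: ce; rewrite /x ger0_norm ?divr_ge0 ?exprn_ge0 ?ltW //.
    rewrite ltr_pdivrMr ?exprn_gt0 // ltr_pdivrMr // -mulrA ltr_pMr //.
    by rewrite -exprSr exprn_egt1 // ltr1n.
  have cge0 : 0 <= cos (a * x).
    apply: cos_ge0_pihalf; rewrite -ler_norml /a /x.
    have -> : t / (e / 2) * (e / 2 / 2 ^+ m.+1) = t / 2 / 2 ^+ m.
      by rewrite exprS; field; rewrite expf_neq0 // gt_eqF.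
    rewrite normrM normfV (ger0_norm (exprn_ge0 _ _)) // ler_pdivrMr ?exprn_gt0 //.
    rewrite normrM normfV (ger0_norm (ler0n _ _)).
    rewrite (@le_trans _ _ (pi / 2)) ?ler_pM2r ?invr_gt0 //.
    by rewrite ler_peMr ?divr_ge0 ?pi_ge0 // exprn_ege1 // ler1n.
  rewrite /H /=; move: IHc IHs; rewrite xx cD sD mulrDr cosD sinD.
  have := cs1 x; have := cos2Dsin2 (a * x).
  move: (cos _) (sin _) (c x) (s x) cpos cge0 => C S u v u0 C0 e1 e2 e3 e4.
  have uC : u = C.
    have : (u - C) * (u + C) = 0 by rewrite -subr_sqr; lra.
    by move/eqP; rewrite mulf_eq0 => /orP[]/eqP ?; lra.
  rewrite uC in u0 e4 *; split=> //.
  by apply: (@mulfI _ C); [rewrite gt_eqF|lra].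
have aH : arbitrarily_small H.
  move=> d d0; have [m md] : exists m : nat, e / 2 / d < m%:R.
    exists (Num.bound (e / 2 / d)); rewrite archi_boundP //.
    by rewrite !divr_ge0 // ltW.
  exists (e / 2 / 2 ^+ m); first exact: Hm.
  rewrite divr_gt0 ?divr_gt0 ?exprn_gt0 //= ltr_pdivrMr ?exprn_gt0 //.
  rewrite [d * _]mulrC -ltr_pdivrMr // (lt_trans md) // -natrX ltr_nat.
  exact: ltn_expl.
exists a => x.
have ca : continuous (fun x => a * x) by move=> y; apply: cvgM;
  [exact: cvg_cst|exact: cvg_id].
split; apply/eqP; rewrite -subr_eq0; apply/eqP; move: x.
  apply: (dense_zero sH aH (f := fun x => c x - cos (a * x))) => [x|x [-> _]];
    last by rewrite subrr.
  apply: cvgB; first exact: cc.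
  by apply: (continuous_comp (ca x)); exact: continuous_cos.
apply: (dense_zero sH aH (f := fun x => s x - sin (a * x))) => [x|x [_ ->]];
  last by rewrite subrr.
apply: cvgB; first exact: cs.
by apply: (continuous_comp (ca x)); exact: continuous_sin.
Qed.

(** Put q = X + i Y. For x in [H] both q (t + x) q 0 and q x q t equal e^(i a) q t q 0, so by
    density they agree for all x; [re] and [im] are the two components. Likewise the modulus of q is
    constant, so q 0 can be divided out unless q vanishes identically. *)
Lemma dense_rotations X Y H : continuous X -> continuous Y ->
  additive_subgroup H -> arbitrarily_small H ->
  (forall x, H x -> exists a, forall t,
     X (t + x) = cos a * X t - sin a * Y t /\ Y (t + x) = sin a * X t + cos a * Y t) ->
  exists a, forall x, X x = cos (a * x) * X 0 - sin (a * x) * Y 0 /\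
                      Y x = sin (a * x) * X 0 + cos (a * x) * Y 0.
Proof.
move=> cX cY sH aH rH.
have cXs t : continuous (fun x => X (t + x)).
  by move=> x; under eq_fun do rewrite addrC; exact: shift_continuous.
have cYs t : continuous (fun x => Y (t + x)).
  by move=> x; under eq_fun do rewrite addrC; exact: shift_continuous.
have norm0 x : X x ^+ 2 + Y x ^+ 2 - (X 0 ^+ 2 + Y 0 ^+ 2) = 0.
  move: x; apply: (dense_zero sH aH) => [x|x /rH[a /(_ 0)]].
    apply: cvgB; last exact: cvg_cst.
    by apply: cvgD; apply: cvgM; (exact: cX || exact: cY).
  rewrite add0r => -[-> ->]; have := cos2Dsin2 a => a1.
  rewrite -[X in _ - X]mul1r -a1; ring.
have re x t : X (t + x) * X 0 - Y (t + x) * Y 0 - (X x * X t - Y x * Y t) = 0.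
  move: x; apply: (dense_zero sH aH) => [x|x /rH[a aE]].
    apply: cvgB; apply: cvgB; apply: cvgM;
    (exact: cXs || exact: cYs || exact: cX || exact: cY || exact: cvg_cst).
  have [-> ->] := aE t; have := aE 0; rewrite add0r => -[-> ->]; ring.
have im x t : X (t + x) * Y 0 + Y (t + x) * X 0 - (X x * Y t + Y x * X t) = 0.
  move: x; apply: (dense_zero sH aH) => [x|x /rH[a aE]].
    apply: cvgB; apply: cvgD; apply: cvgM;
    (exact: cXs || exact: cYs || exact: cX || exact: cY || exact: cvg_cst).
  have [-> ->] := aE t; have := aE 0; rewrite add0r => -[-> ->]; ring.
set r := X 0 ^+ 2 + Y 0 ^+ 2 in norm0.
have [r0|r0] := eqVneq r 0.
  exists 0 => x; have := norm0 x; have := norm0 0; rewrite r0 !subr0.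
  move=> /eqP; rewrite paddr_eq0 ?sqr_ge0 // !sqrf_eq0 => /andP[/eqP-> /eqP->] /eqP.
  rewrite paddr_eq0 ?sqr_ge0 // !sqrf_eq0 => /andP[/eqP-> /eqP->].
  by rewrite !mulr0 subr0 addr0.
(* The real and imaginary parts of q x / q 0. *)
pose c x := (X x * X 0 + Y x * Y 0) / r.
pose s x := (Y x * X 0 - X x * Y 0) / r.
have Xw x : X x = c x * X 0 - s x * Y 0.
  by rewrite /c /s; apply: (mulIf r0);
    rewrite mulrBl ![_ / r * _ * r]mulrAC !divfK // /r; ring.
have Yw x : Y x = s x * X 0 + c x * Y 0.
  by rewrite /c /s; apply: (mulIf r0);
    rewrite mulrDl ![_ / r * _ * r]mulrAC !divfK // /r; ring.
(* This says that (E + i F) (q 0)^2 = 0 implies E + i F = 0, in real coordinates. *)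
have w0 E F : E * (X 0 ^+ 2 - Y 0 ^+ 2) - F * (2 * X 0 * Y 0) = 0 ->
    E * (2 * X 0 * Y 0) + F * (X 0 ^+ 2 - Y 0 ^+ 2) = 0 -> E = 0 /\ F = 0.
  set p := X 0 ^+ 2 - _; set q := 2 * _ * _ => e1 e2.
  have rE : r * r = p * p + q * q by rewrite /r /p /q; ring.
  split; apply: (mulfI (mulf_neq0 r0 r0)); rewrite mulr0 rE.
    have -> : (p * p + q * q) * E = p * (E * p - F * q) + q * (E * q + F * p) by ring.
    by rewrite e1 e2 !mulr0 addr0.
  have -> : (p * p + q * q) * F = p * (E * q + F * p) - q * (E * p - F * q) by ring.
  by rewrite e1 e2 !mulr0 subr0.
have wD t x : c (t + x) - (c t * c x - s t * s x) = 0 /\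
              s (t + x) - (s t * c x + c t * s x) = 0.
  have := re x t; have := im x t.
  rewrite (Xw (t + x)) (Yw (t + x)) (Xw x) (Xw t) (Yw x) (Yw t) => im0 re0.
  by apply: w0; [rewrite -[RHS]re0; ring|rewrite -[RHS]im0; ring].
have wD1 := fun t x => subr0_eq (wD t x).1.
have wD2 := fun t x => subr0_eq (wD t x).2.
have [||//|//|x|a aE] := @continuous_character c s.
- by move=> x; apply: cvgM; [apply: cvgD; apply: cvgM;
  (exact: cX || exact: cY || exact: cvg_cst)|exact: cvg_cst].
- by move=> x; apply: cvgM; [apply: cvgB; apply: cvgM;
  (exact: cX || exact: cY || exact: cvg_cst)|exact: cvg_cst].
- have nx := subr0_eq (norm0 x); apply: (mulIf (mulf_neq0 r0 r0)).
  have -> : (c x ^+ 2 + s x ^+ 2) * (r * r) = (c x * r) ^+ 2 + (s x * r) ^+ 2 by ring.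
  by rewrite /c /s !divfK // mul1r -{1}nx /r; ring.
- by exists a => x; have [<- <-] := aE x; split.
Qed.

End RealLine.

(** * Continuity of real and imaginary parts and of the bodies' coordinates *)

Section ReIm.
Variable R : realType.

Lemma Re_continuous : continuous (fun z : R[i] => complex.Re z).
Proof.
move=> z; apply/(@cvgrPdist_lt _ R _ (nbhs z)) => e e0.
(* The norm of [R[i]] takes its values in [R[i]], so the radius is embedded there. *)
have e0' : 0 < e%:C by rewrite ltcR.
have : \forall y \near z, `|z - y| < e%:C.
  exact: (@nbhsx_ballx _ (R[i])^o z _ e0').
apply: filterS => y /(le_lt_trans (normc_ge_Re _)).
by rewrite ltcR; case: z y => [? ?] [? ?].
Qed.

Lemma Im_continuous : continuous (fun z : R[i] => complex.Im z).
Proof.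
have Im_le (z : R[i]) : (`|complex.Im z|)%:C <= `|z|.
  (* The right-hand side is the modulus of i z, whose real part is minus the imaginary part of z. *)
  have -> : `|z| = `|(- complex.Im z) +i* complex.Re z|.
    by rewrite !normc_def /= sqrrN addrC.
  by rewrite -normrN; exact: (normc_ge_Re (- complex.Im z +i* complex.Re z)).
move=> z; apply/(@cvgrPdist_lt _ R _ (nbhs z)) => e e0.
have e0' : 0 < e%:C by rewrite ltcR.
have : \forall y \near z, `|z - y| < e%:C.
  exact: (@nbhsx_ballx _ (R[i])^o z _ e0').
apply: filterS => y /(le_lt_trans (Im_le _)).
by rewrite ltcR; case: z y => [? ?] [? ?].
Qed.

Lemma toT_continuous : continuous (@toT R).
Proof. exact: pi_continuous. Qed.

Lemma coordinate_continuous n (u : loop R n) j : continuous u ->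
  continuous (fun x => u (toT x) 0 j).
Proof.
move=> cu x; apply: (@continuous_comp _ _ _ (fun x => u (toT x)) (fun v : 'rV[R[i]]_n => v 0 j)).
  by apply: continuous_comp; [exact: toT_continuous|exact: cu].
exact: coord_continuous.
Qed.

End ReIm.

(** * Symmetries of a choreography *)

Section O2Plane.
Variable R : realType.
Implicit Types (A : O2 R) (a x y : R) (z w : R[i]).

(** The axis is the line through the origin at angle [a]; the body has the shape given by [O2P]. *)
Definition reflection a : O2 R := (plane_rot a * kappa R * plane_rot (- a))%g.

Lemma reflectionE a : reflection a = (kappa R ^ plane_rot (- a))%g.
Proof. by rewrite /reflection conjgE plane_rotN invgK mulgA. Qed.

Lemma reflection_sqr a : (reflection a * reflection a = 1)%g.
Proof. by rewrite reflectionE -conjMg kappa_sqr conj1g. Qed.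

Lemma reflectionM a b : (reflection a * reflection b)%g = plane_rot (a + a - b - b).
Proof.
rewrite /reflection -!mulgA (mulgA (plane_rot (- a))) -plane_rotD (mulgA (kappa R) (plane_rot _)).
rewrite kappa_rot -!mulgA (mulgA (kappa R)) kappa_sqr mul1g -!plane_rotD;
  congr plane_rot; ring.
Qed.

Lemma reflection_neq1 a : reflection a <> 1%g.
Proof.
rewrite reflectionE => /eqP; rewrite conjg_eq1 => /eqP/(congr1 (fun A : O2 R => val A 1 1)).
by rewrite !mxE /=; lra.
Qed.

Lemma cis0 : cis 0 = 1 :> R[i].
Proof. by rewrite /cis cos0 sin0. Qed.

Lemma cisD x y : cis (x + y) = cis x * cis y :> R[i].
Proof. by rewrite -[RHS]plane_rotE; rewrite /cis cosD sinD /O2_act !mxE /=;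
  congr (_ +i* _); ring. Qed.

Lemma cis_neq0 a : cis a != 0 :> R[i].
Proof.
apply/eqP => a0; have := cisD a (- a); rewrite subrr cis0 a0 mul0r => /eqP.
by rewrite oner_eq0.
Qed.

Lemma cis_eq1 a : cis a = 1 :> R[i] -> plane_rot a = 1%g.
Proof.
move=> [ca sa]; apply: val_inj; apply/matrixP => i j; rewrite !mxE ca sa oppr0.
by case/orP: (ord2P i) => /eqP ->; case/orP: (ord2P j) => /eqP ->.
Qed.

(** Multiplication by [cis (- a)] turns the axis onto the real line, where the reflection becomes
    complex conjugation. *)
Lemma reflection_act a z : cis (- a) * O2_act (reflection a) z = (cis (- a) * z)^*%C.
Proof.
by rewrite !O2_actM !plane_rotE kappaE mulrA -cisD addNr cis0 mul1r.
Qed.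

End O2Plane.

(** * Isotropy groups of loops *)

Section LoopSymmetries.
Variables (R : realType) (n : nat) (u : loop R n).

Lemma symmetry_group_subgroup : is_subgroup (symmetry_group u).
Proof.
split=> [|g h gu hu|g gu]; first exact: loop_act1.
- by rewrite /symmetry_group /mkset loop_actM hu gu.
- by rewrite /symmetry_group /mkset -{1}gu -loop_actM mulVg loop_act1.
Qed.

Lemma symmetry_groupP A s tau : symmetry_group u (A, s, tau) <->
  forall t j, O2_act A (u t 0 j) = u (S1hat_act tau t) 0 (Sn_act s j).
Proof.
split=> [gu t j|gu].
  have /(congr1 (fun v : loop R n => v (S1hat_act tau t) 0 (Sn_act s j))) := gu.
  by rewrite /= mxE -S1hat_actM mulVg S1hat_act1 -Sn_actM mulVg /Sn_act perm1.
apply/funext => t; apply/rowP => j.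
by rewrite /= mxE gu -S1hat_actM mulgV S1hat_act1 -Sn_actM mulgV /Sn_act perm1.
Qed.

Lemma toT0 : toT 0 = 0 :> circle R.
Proof. exact: raddf0. Qed.

Lemma toT_repr (t : circle R) : toT (repr t) = t.
Proof. exact: reprK. Qed.

Lemma conjugate_loop_act g : conjugate (symmetry_group (loop_act g u)) (symmetry_group u).
Proof.
exists g^-1%g; apply/seteqP; split=> [h hg|_ [h hu <-]].
  exists (h ^ g)%g; last by rewrite conjgK.
  by rewrite /symmetry_group /mkset conjgE !loop_actM hg -loop_actM mulVg loop_act1.
rewrite /symmetry_group /mkset -loop_actM conjgE invgK !loop_actM.
by rewrite -(loop_actM g^-1) mulVg loop_act1 hu.
Qed.

Lemma sym_mulE A B s r a b :
  ((A, s, a) * (B, r, b) = (A * B, s * r, a * b) :> sym R n)%g.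
Proof. by []. Qed.

Lemma sym_invE A s a : ((A, s, a)^-1 = (A^-1, s^-1, a^-1) :> sym R n)%g.
Proof. by []. Qed.

Lemma choreography_iter k : (chor R n ^+ k = (1, sigma1 n ^+ k, Rot (toT (- (k%:R / n%:R)))))%g.
Proof.
elim: k => [|k IHk].
  by rewrite !expg0 mul0r oppr0 toT0.
rewrite !expgS IHk; congr (_, _, _); first exact: mulg1.
by congr Rot; rewrite -toTD -opprD -natr1 mulrDl mul1r addrC.
Qed.

End LoopSymmetries.

(** * The curve of one body and the constraints imposed by the absence of collisions *)

Section Choreography.
Variables (R : realType) (m : nat).
Let n := m.+1.
Variable u : loop R n.
Hypothesis (n_ge3 : (3 <= n)%N) (chor_u : choreography u).

Let G := symmetry_group u.
Let sG : is_subgroup G := symmetry_group_subgroup u.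
(** The curve is lifted to the real line, so that time shifts and the delays between bodies become
    real arithmetic. *)
Let Q (x : R) : R[i] := u (toT x) 0 ord0.

Let n0 : n%:R != 0 :> R. Proof. by rewrite pnatr_eq0. Qed.

Lemma body_shift x j : u (toT x) 0 j = Q (x + j%:R / n%:R).
Proof.
case: j => k; elim: k x => [|k IHk] x kn.
  by rewrite /Q /= mul0r addr0; congr (u _ 0 _); exact: val_inj.
have -> : Ordinal kn = ordS (Ordinal (ltnW kn)).
  by apply: val_inj; rewrite /= modn_small.
rewrite ((chor_fixedP u).1 chor_u.2) -toTD IHk /=.
by rewrite modn_small // -(natr1 k) mulrDl mul1r -addrA [n%:R^-1 + _]addrC.
Qed.

Lemma base_periodic x (k : int) : Q (x + k%:~R) = Q x.
Proof. by congr (u _ 0 _); apply/toT_eq; exists k; rewrite addrAC subrr add0r. Qed.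

Lemma body_shift_mod x k : u (toT x) 0 (inZp k) = Q (x + k%:R / n%:R).
Proof.
have -> : x + k%:R / n%:R = x + (k %% n)%:R / n%:R + (k %/ n)%:Z%:~R.
  by rewrite {1}(divn_eq k n) natrD natrM mulrDl mulfK // -addrA [X in x + X]addrC.
by rewrite body_shift base_periodic.
Qed.

(** The absence of collisions, read on the single curve [Q]. *)
Lemma base_inj x i j : Q (x + i%:R / n%:R) = Q (x + j%:R / n%:R) -> (i = j %[mod n])%N.
Proof.
rewrite -!body_shift_mod => uij;
  have [_ /(_ (inZp i) (inZp j)) ucoll] := chor_u.1.2 (toT x).
apply/eqP; apply: contraT => ij;
  suff : u (toT x) 0 (inZp i) != u (toT x) 0 (inZp j) by rewrite uij eqxx.
by apply: ucoll; apply: contra ij => /eqP/(congr1 val) /= ->.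
Qed.

Lemma symRotP A s y : G (A, s, Rot (toT y)) <->
  forall x (j : 'I_n), O2_act A (Q (x + j%:R / n%:R)) = Q (x + y + (Sn_act s j)%:R / n%:R).
Proof.
split=> [/symmetry_groupP Gs x j|Gs].
  by rewrite -!body_shift Gs /= -toTD.
apply/symmetry_groupP => t j; rewrite -(toT_repr t) /= -toTD !body_shift; exact: Gs.
Qed.

Lemma symReflP A s y : G (A, s, Refl (toT y)) <->
  forall x (j : 'I_n), O2_act A (Q (x + j%:R / n%:R)) = Q (y - x + (Sn_act s j)%:R / n%:R).
Proof.
split=> [/symmetry_groupP Gs x j|Gs].
  by rewrite -!body_shift Gs /= -toTN -toTD.
apply/symmetry_groupP => t j; rewrite -(toT_repr t) /= -toTN -toTD !body_shift; exact: Gs.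
Qed.

(** The point Q (x + j/n) is body j at time x and also body 0 at time x + j/n. Comparing the two
    images under [A] gives s j = s 0 + j modulo n. *)
Lemma symRot_perm A s y : G (A, s, Rot (toT y)) -> s = (sigma1 n ^+ Sn_act s ord0)%g.
Proof.
move=> /symRotP Gs; apply/permP => j; apply: val_inj.
apply: (etrans _ (esym (sigma1_exp _ j)));
  apply: (etrans (esym (modn_small (ltn_ord (Sn_act s j))))).
apply: (base_inj (x := 0 + y)); rewrite -Gs natrD mulrDl addrA.
by rewrite [0 + y + _]addrAC -Gs mul0r addr0.
Qed.

(** The comparison used for [symRot_perm] now gives s j + j = s 0 modulo n, because the delay j/n
    changes sign under time reversal. *)
Lemma symRefl_perm A s y : G (A, s, Refl (toT y)) ->
  exists k, s = (sigma1 n ^+ k * s1 n)%g.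
Proof.
(* Since [s1] sends j to 2 - j, the exponent is s 0 - 2 modulo n; adding n - 2 avoids truncated
   subtraction. *)
move=> /symReflP Gs; exists (Sn_act s ord0 + (n - 2))%N; apply/permP => j; apply: val_inj.
have jn := ltn_ord j.
have Hj : (Sn_act s j + j = Sn_act s ord0 %[mod n])%N.
  apply: (base_inj (x := y - j%:R / n%:R)).
  have -> : y - j%:R / n%:R + (Sn_act s j + j)%:R / n%:R = y - 0 + (Sn_act s j)%:R / n%:R.
    by rewrite natrD mulrDl; ring.
  rewrite -Gs add0r.
  by have := Gs (j%:R / n%:R) ord0; rewrite mul0r addr0.
apply: (etrans _ (esym (congr1 val (Sn_actM _ _ j)))).
apply: (etrans _ (esym (sigma1_exp _ (Sn_act (s1 n) j))));
  apply: (etrans (esym (modn_small (ltn_ord (Sn_act s j))))).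
apply/eqP; rewrite -(eqn_modDr j).
rewrite addnAC Hj -(modnDml (Sn_act _ _ + _)) s1E modnDml addnCA subnKC ?(ltnW n_ge3) //.
by rewrite modnDr.
Qed.

Lemma symmetry_decomp g : G g -> exists k h, [/\ g = (chor R n ^+ k * h)%g, G h &
  (exists A y, h = (A, 1%g, Rot (toT y))) \/ (exists A y, h = (A, s1 n, Refl (toT y)))].
Proof.
move=> Gg; have [_ GM GV] := sG.
have Gc k : G ((chor R n ^+ k)^-1)%g by exact: GV (subgroupX k sG chor_u.2).
case: g Gg => [[A s] [t|t]] Gg; rewrite -(toT_repr t) in Gg *.
- exists (Sn_act s ord0).
  exists ((chor R n ^+ Sn_act s ord0)^-1 * (A, s, Rot (toT (repr t))))%g; split.
  + by rewrite mulVKg.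
  + exact: GM.
  + left; exists A, ((Sn_act s ord0)%:R / n%:R + repr t).
    rewrite choreography_iter {3}(symRot_perm Gg) sym_invE sym_mulE invg1 mul1g mulVg.
    by congr (_, _, Rot _); rewrite toTN opprK toTD.
- have [k sk] := symRefl_perm Gg; exists k.
  exists ((chor R n ^+ k)^-1 * (A, s, Refl (toT (repr t))))%g; split.
  + by rewrite mulVKg.
  + exact: GM.
  + right; exists A, (k%:R / n%:R + repr t).
    rewrite choreography_iter {1}sk sym_invE sym_mulE invg1 mul1g mulKg.
    by congr (_, _, Refl _); rewrite toTN opprK toTD.
Qed.

Lemma time_shift_trivial y : least_period_one u -> G (1%g, 1%g, Rot (toT y)) -> toT y = 0.
Proof.
move=> per /symmetry_groupP Gy; apply: per => t; apply/rowP => j.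
by have := Gy t j; rewrite O2_act1 /Sn_act perm1 /= => ->.
Qed.

Lemma base_shift_neq x : Q (x + n%:R^-1) <> Q x.
Proof.
move=> Qx; have := @base_inj x 1 0; rewrite mul1r mul0r addr0 => /(_ Qx).
by rewrite mod0n modn_small // (ltn_trans _ n_ge3).
Qed.

(** For even n the half period is a multiple of 1/n, so it leads from one body to another. *)
Lemma base_half_neq x : ~~ odd n -> Q (x + 1 / 2) <> Q x.
Proof.
move=> en Qx; have nE := even_halfK en.
have := @base_inj x n./2 0; rewrite mul0r addr0.
have -> : n./2%:R / n%:R = 1 / 2 :> R.
  by rewrite -{2}nE -muln2 natrM; field; rewrite !pnatr_eq0; lia.
by move=> /(_ Qx); rewrite mod0n modn_small; lia.
Qed.

(** The time is chosen so that the reversal exchanges x and x + 1/n, which makes two bodies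
    collide. *)
Lemma no_time_reversal s y : ~ G (1%g, s, Refl (toT y)).
Proof.
move=> /symReflP/(_ ((y + (Sn_act s ord0)%:R / n%:R - n%:R^-1) / 2) ord0).
rewrite O2_act1 mul0r addr0 => Qx.
apply: (@base_shift_neq ((y + (Sn_act s ord0)%:R / n%:R - n%:R^-1) / 2)).
by rewrite [RHS]Qx; congr Q; field.
Qed.

Lemma base_continuous_Re w : continuous (fun x => complex.Re (w * Q x)).
Proof.
have cQ := coordinate_continuous (j := ord0) chor_u.1.1.
have -> : (fun x => complex.Re (w * Q x)) =
    (fun x => complex.Re w * complex.Re (Q x) - complex.Im w * complex.Im (Q x)).
  by apply/funext => x; case: w (Q x) => [? ?] [? ?].
move=> x; apply: cvgB; (apply: cvgM; first exact: cvg_cst).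
  exact: (continuous_comp (cQ x) (@Re_continuous _ _)).
exact: (continuous_comp (cQ x) (@Im_continuous _ _)).
Qed.

Lemma base_continuous_Im w : continuous (fun x => complex.Im (w * Q x)).
Proof.
have -> : (fun x => complex.Im (w * Q x)) = (fun x => complex.Re ((- 'i * w) * Q x)).
  by apply/funext => x; case: w (Q x) => [? ?] [? ?] /=; ring.
exact: base_continuous_Re.
Qed.

(** The component of the curve normal to the axis changes sign under the shift, so it vanishes
    somewhere; there the curve meets the axis and the reflection fixes the point. *)
Lemma reflection_fixed_shift a y :
  (forall x, O2_act (reflection a) (Q x) = Q (x + y)) ->
  exists x, complex.Im (cis (- a) * Q x) = 0 /\ Q (x + y) = Q x.
Proof.
move=> AQ; have rQ x : cis (- a) * Q (x + y) = (cis (- a) * Q x)^*%C.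
  by rewrite -AQ reflection_act.
have qN x : complex.Im (cis (- a) * Q (x + y)) = - complex.Im (cis (- a) * Q x).
  by rewrite rQ; case: (cis _ * _).
have [x qx] := antiperiodic_zero (base_continuous_Im (w := cis (- a))) qN.
exists x; split=> //; apply: (mulfI (cis_neq0 (- a))); rewrite rQ.
by move: qx; case: (cis _ * _) => p q /= ->; rewrite oppr0.
Qed.

(** A rotation that fixes a nonzero point of the curve is trivial. A reflection that fixes the curve
    confines it to its axis. *)
Lemma trivial_isotropy A : G (A, 1%g, Rot (toT 0)) -> A = 1%g.
Proof.
move=> /symRotP GA.
have {}GA x : O2_act A (Q x) = Q x.
  by have := GA x ord0; rewrite /Sn_act perm1 /= mul0r !addr0.
have [[a Aa]|[a Aa]] := O2P A; rewrite Aa in GA *.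
  apply: cis_eq1.
  have [x Qx] : exists x, Q x != 0.
    apply: contrapT => /forallNP Q0; apply: (@base_shift_neq 0).
    have {}Q0 x : Q x = 0 by apply/eqP/negP => /negP; exact: Q0.
    by rewrite !Q0.
  by apply: (mulIf Qx); rewrite -plane_rotE GA mul1r.
have q0 x : complex.Im (cis (- a) * Q x) = 0.
  have := reflection_act a (Q x); rewrite GA.
  by case: (cis _ * _) => p q [] /=; lra.
(* On a line, a periodic function takes equal values at some x and x + 1/n, which is a collision. *)
have [x px] := @periodic_shift_fixed _ (fun x => complex.Re (cis (- a) * Q x)) n isT
  (base_continuous_Re (w := cis (- a))) (fun x => congr1 (fun z => complex.Re (cis (- a) * z)) (base_periodic x 1)).
case: (@base_shift_neq x); apply: (mulfI (cis_neq0 (- a))).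
by apply/eqP; rewrite eq_complex px !q0 !eqxx.
Qed.

(** Where the curve meets the axis, the shift by 1/2 returns to the same point; for even n this is a
    collision. *)
Lemma half_period_reflection_odd a : G (reflection a, 1%g, Rot (toT (1 / 2))) -> odd n.
Proof.
move=> /symRotP GA; apply: contraT => en.
have [x|x [_ Qx]] := @reflection_fixed_shift a (1 / 2).
  by have := GA x ord0; rewrite /Sn_act perm1 /= mul0r !addr0.
by case: (base_half_neq en Qx).
Qed.

Lemma cis_pi : cis pi = -1 :> R[i].
Proof. by rewrite /cis cospi sinpi; apply/eqP; rewrite eq_complex /= oppr0 !eqxx. Qed.

(** At each of the two fixed times of the reversal, half a period apart, the curve equals its
    negative and passes through the origin. For even n two bodies meet there. *)
Lemma reversing_half_turn_odd s y : G (plane_rot pi, s, Refl (toT y)) -> odd n.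
Proof.
move=> /symReflP GA; apply: contraT => en.
pose z := y + (Sn_act s ord0)%:R / n%:R.
have {}GA x : - Q x = Q (z - x).
  have := GA x ord0; rewrite plane_rotE cis_pi mulN1r mul0r addr0 => ->.
  by congr Q; rewrite /z; ring.
have fix0 x : Q (z - x) = Q x -> Q x = 0.
  by rewrite -GA => Qx; apply/eqP; rewrite -oppr_eq0 Qx; move: Qx; case: (Q x) => p q [];
    rewrite eq_complex /=; lra.
have h0 : Q (z / 2) = 0 by apply: fix0; congr Q; field.
have h1 : Q (z / 2 + 1 / 2) = 0.
  by apply: fix0; rewrite -(base_periodic _ 1); congr Q; rewrite -[1%:~R]/1; field.
by case: (@base_half_neq (z / 2) en); rewrite h0 h1.
Qed.

Let times := [set x : R | exists A, G (A, 1%g, Rot (toT x))].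

Lemma times_subgroup : additive_subgroup times.
Proof.
have [G1 GM GV] := sG; split=> [|x y [A GA] [B GB]|x [A GA]].
- by exists 1%g; rewrite toT0.
- by exists (A * B)%g; have := GM _ _ GA GB; rewrite sym_mulE toTD mul1g.
- by exists (A^-1)%g; have := GV _ GA; rewrite sym_invE toTN invg1.
Qed.

Lemma dense_times_circular : arbitrarily_small times -> is_circular u.
Proof.
(* The plane part over a doubled time is a square in O(2), hence a rotation even if the isometry
   itself is a reflection. *)
move=> aT; pose D := [set x : R | exists2 y, times y & x = y + y].
have sD : additive_subgroup D.
  have [T0 TD TN] := times_subgroup; split=> [|_ _ [x Tx ->] [y Ty ->]|_ [x Tx ->]].
  - by exists 0; rewrite ?addr0.
  - by exists (x + y); [exact: TD|rewrite addrACA].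
  - by exists (- x); [exact: TN|rewrite opprD].
have aD : arbitrarily_small D.
  move=> e e0; have [d Td /andP[d0 de]] := aT (e / 2) (divr_gt0 e0 (ltr0Sn _ 1)).
  by exists (d + d); [exists d|lra].
pose X x := complex.Re (Q x); pose Y x := complex.Im (Q x).
have cX : continuous X.
  by have := @base_continuous_Re 1; under eq_fun do rewrite mul1r.
have cY : continuous Y.
  by have := @base_continuous_Im 1; under eq_fun do rewrite mul1r.
have [x [y [A GA] ->]|a aE] := dense_rotations cX cY sD aD.
  have [a Aa] : exists a, (A * A = plane_rot a)%g.
    have [[a ->]|[a ->]] := O2P A; first by exists (a + a); rewrite plane_rotD.
    by exists 0; rewrite reflection_sqr plane_rot0.
  exists a => t.
  have : O2_act (A * A)%g (Q t) = Q (t + (y + y)).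
    move/symRotP: GA => GA; have {}GA s : O2_act A (Q s) = Q (s + y).
      by have := GA s ord0; rewrite /Sn_act perm1 /= mul0r !addr0.
    by rewrite O2_actM !GA addrA.
  by rewrite Aa plane_rotE /X /Y => <-; case: (Q t) => p q; split=> /=; ring.
have QE x : Q x = Q 0 * cis (a * x).
  have [Xx Yx] := aE x; rewrite /X /Y in Xx Yx.
  by apply/eqP; rewrite eq_complex Xx Yx; case: (Q 0) => p q /=; apply/andP; split;
    apply/eqP; ring.
have Q0 : Q 0 != 0.
  by apply/eqP => Q0; apply: (@base_shift_neq 0); rewrite QE (QE 0) Q0 !mul0r.
(* Period 1 forces the angular speed to be an integer multiple of 2 pi. *)
have [l al] : exists l : int, a = 2 * pi * l%:~R.
  apply/plane_rot_eq1/cis_eq1/(mulfI Q0); rewrite -[a]mulr1 -QE mulr1.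
  by rewrite -[1]add0r (base_periodic 0 1).
exists (Q 0), l => t; apply/rowP => j; rewrite -(toT_repr t) body_shift QE.
rewrite mxE circularE -cisD; congr (_ * cis _); rewrite al; ring.
Qed.

End Choreography.

(** * Classification *)

Section Conjugation.
Variables (R : realType) (n : nat).
Implicit Types (A B : O2 R) (s : Sn n) (x y d a : R).

Lemma sym_conjE A s al B b :
  ((A, s, al) ^ (B, 1, b) = (A ^ B, s, al ^ b) :> sym R n)%g.
Proof. by rewrite conjgE sym_invE !sym_mulE !conjgE invg1 mul1g mulg1. Qed.

Lemma Refl_Refl x y : (Refl (toT x) * Refl (toT y))%g = Rot (toT (x - y)).
Proof. by rewrite toTD toTN. Qed.

Lemma Refl_Rot x y : (Refl (toT x) * Rot (toT y))%g = Refl (toT (x - y)).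
Proof. by rewrite toTD toTN. Qed.

Lemma Rot_Rot x y : (Rot (toT x) * Rot (toT y))%g = Rot (toT (x + y)).
Proof. by rewrite toTD. Qed.

Lemma chor_conj B y : (chor R n ^ (B, 1, Rot (toT y)) = chor R n)%g.
Proof.
rewrite sym_conjE conj1g; congr (_, _, _).
by rewrite conjgE; congr Rot; rewrite addrC addrK.
Qed.

Lemma plane_rot_conj a b : (plane_rot a ^ plane_rot b = plane_rot a :> O2 R)%g.
Proof. by rewrite conjgE plane_rotC mulKg. Qed.

Lemma Rot_conj x y : (Rot (toT x) ^ Rot (toT y) = Rot (toT x))%g.
Proof. by rewrite conjgE; congr Rot; rewrite addrC addrK. Qed.

Lemma Refl_conj x d : (Refl (toT x) ^ Rot (toT d) = Refl (toT (x - d - d)))%g.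
Proof. by rewrite conjgE; congr Refl; rewrite !toTD !toTN addrC. Qed.

Lemma rot_iter A y k : (((A, 1, Rot (toT y)) : sym R n) ^+ k = (A ^+ k, 1, Rot (toT (k%:R * y))))%g.
Proof.
elim: k => [|k IHk]; first by rewrite !expg0 mul0r toT0.
rewrite !expgS IHk sym_mulE mulg1; congr (_, _, Rot _).
by rewrite -toTD -natr1 mulrDl mul1r addrC.
Qed.

End Conjugation.

(** * Generators of the model groups *)

Section Generators.
Variables (R : realType) (n : nat).

Lemma conjugate_refl (H : set (sym R n)) : conjugate H H.
Proof.
by exists 1%g; apply/seteqP; split=> [h Hh|_ [h Hh <-]]; [exists h|]; rewrite ?conjg1.
Qed.

Lemma conjgVE (g x y : sym R n) : (x ^ g = y -> y ^ g^-1 = x)%g.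
Proof. by move=> <-; rewrite conjgK. Qed.

Lemma D_groupE k l : D_group R n k l =
  gen [set chor R n; (plane_rot (2 * pi * (l%:R / k%:R)), 1%g, Rot (toT k%:R^-1));
           (kappa R, s1 n, Refl (toT 0))].
Proof.
apply: eq_gen => [g [Cg|->]|g [[->|->]|->]].
- apply: gen_sub Cg; first exact: gen_is_subgroup.
  by move=> _ [->|->]; apply: sub_gen; left; [left|right].
- by apply: sub_gen; right.
- by apply: sub_gen; left; apply: sub_gen; left.
- by apply: sub_gen; left; apply: sub_gen; right.
- by apply: sub_gen; right.
Qed.

(** With [kappa] this is the generator of [C'2_group]; the plane part is left free to cover its
    conjugates by rotations. *)
Definition half_chor (A : O2 R) : sym R n := (A, sigma2 n, Rot (toT (- (2 * n%:R)^-1))).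

Lemma half_chor_sqr A : (0 < n)%N -> odd n -> (A * A = 1)%g ->
  (half_chor A ^+ 2 = chor R n)%g.
Proof.
move=> n0 on AA; rewrite expg2 sym_mulE AA sigma2_sqr // Rot_Rot.
congr (_, _, Rot (toT _)); field; by rewrite pnatr_eq0 -lt0n.
Qed.

(** The (n+1)/2-th power of [chor] already has permutation [sigma2], and its time shift -(n+1)/(2n)
    differs from -1/(2n) by a half period. *)
Lemma half_chorE A : (0 < n)%N -> odd n ->
  half_chor A = (chor R n ^+ (n.+1)./2 * (A, 1, Rot (toT 2^-1)))%g.
Proof.
move=> n0 on; rewrite choreography_iter sym_mulE mulg1 mul1g Rot_Rot.
congr (_, _, Rot (toT _)).
have -> : (n.+1)./2%:R = (n%:R + 1) / 2 :> R.
  have := odd_double_half n.+1; rewrite oddS on add0n -muln2 => h.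
  by rewrite natr1 -[in RHS]h natrM mulfK // pnatr_eq0.
by field; rewrite pnatr_eq0 -lt0n.
Qed.

End Generators.

(** * Discrete times: structure of the group and its five families *)

Section FiniteTimes.
Variables (R : realType) (m : nat).
Let n := m.+1.
Variables (u : loop R n) (k : nat) (A1 : O2 R).
Hypotheses (n_ge3 : (3 <= n)%N) (chor_u : choreography u) (per : least_period_one u).
Hypotheses (k_gt0 : (0 < k)%N).

Let G := symmetry_group u.
Let r : sym R n := (A1, 1%g, Rot (toT k%:R^-1)).
Hypothesis Gr : G r.
Hypothesis times_k : forall A x, G (A, 1%g, Rot (toT x)) ->
  exists i : int, x = i%:~R / k%:R.

Let sG : is_subgroup G := symmetry_group_subgroup u.
Let GM x y : G x -> G y -> G (x * y)%g. Proof. by have [_ GM _] := sG; exact: GM. Qed.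
Let GV x : G x -> G (x^-1)%g. Proof. by have [_ _ GV] := sG; exact: GV. Qed.

Let k0 : k%:R != 0 :> R. Proof. by rewrite pnatr_eq0 -lt0n. Qed.

(** The quotient of the two symmetries moves neither time nor bodies, so [trivial_isotropy]
    applies. *)
Lemma plane_part_unique A B x y : toT x = toT y ->
  G (A, 1%g, Rot (toT x)) -> G (B, 1%g, Rot (toT y)) -> A = B.
Proof.
move=> xy GA GB; rewrite -xy in GB; have := GM GA (GV GB);
  rewrite sym_invE sym_mulE invg1 mulg1.
have -> : (Rot (toT x) * (Rot (toT x))^-1)%g = Rot (toT 0) by rewrite mulgV toT0.
move=> /(trivial_isotropy n_ge3 chor_u) AB.
by rewrite -[A](mulgVK B) AB mul1g.
Qed.

Lemma time_shift_power A x : G (A, 1%g, Rot (toT x)) ->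
  exists i, (A, 1%g, Rot (toT x)) = (r ^+ i)%g.
Proof.
move=> GA; have [i xi] := times_k GA.
have kz : (k : int) != 0 by rewrite eqz_nat -lt0n.
have [j ij] : exists j : nat, (i %% k)%Z = j.
  by have := modz_ge0 i kz; case: (i %% k)%Z => // j _; exists j.
have xE : toT x = toT (j%:R * k%:R^-1).
  apply/toT_eq; exists (i %/ k)%Z;
    rewrite xi {1}(divz_eq i k) ij intrD intrM mulrDl mulfK //.
  by rewrite addrK.
exists j; rewrite rot_iter; have := subgroupX j sG Gr; rewrite rot_iter => GAj.
by rewrite (plane_part_unique xE GA GAj) xE.
Qed.

Lemma plane_part_power : (A1 ^+ k = 1)%g.
Proof.
have := subgroupX k sG Gr; rewrite rot_iter divff // => GAk.
have [G1 _ _] := sG; apply: (plane_part_unique (y := 0) _ GAk); last by rewrite toT0.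
by apply/toT_eq; exists 1; rewrite subr0.
Qed.

(** If the i-th power is trivial, then [r ^+ i] is a pure time shift by i/k, which the least period
    forces to be an integer. With [plane_part_power], the order of [A1] is exactly k. *)
Lemma plane_part_order i : (A1 ^+ i = 1)%g -> (k %| i)%N.
Proof.
move=> A1i; have := subgroupX i sG Gr; rewrite rot_iter A1i => Gi.
have := time_shift_trivial per Gi; rewrite -toT0 => /toT_eq[j]; rewrite subr0 => ij.
apply/dvdnP; exists `|j|%N; apply/eqP; rewrite -(eqr_nat R) natrM natr_absz.
have j0 : 0 <= j by rewrite -(ler0z R) -ij divr_ge0.
by rewrite ger0_norm // -ij divfK.
Qed.

Lemma generated_rotations : (forall A y, ~ G (A, s1 n, Refl (toT y))) ->
  G = gen [set chor R n; r].
Proof.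
move=> noR; apply/seteqP; split; last by apply: gen_sub => // _ [->|->] //; exact: chor_u.2.
have sT := gen_is_subgroup [set chor R n; r]; have [_ TM _] := sT.
move=> g /(symmetry_decomp n_ge3 chor_u)[i [h [-> Gh]]].
move=> [[A [y hE]]|[A [y hE]]]; last by case: (noR A y); rewrite -hE.
apply: (TM _ _); first by apply: (subgroupX _ sT); apply: sub_gen; left.
rewrite hE in Gh *; have [j ->] := time_shift_power Gh.
by apply: (subgroupX _ sT); apply: sub_gen; right.
Qed.

(** Two time-reversing symmetries over [s1] differ by a pure rotation of time, which is a power of
    [r]. *)
Lemma generated_reflections A0 y0 : G (A0, s1 n, Refl (toT y0)) ->
  G = gen [set chor R n; r; (A0, s1 n, Refl (toT y0))].
Proof.
set rho := (A0, _, _) => Grho; apply/seteqP; split; last first.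
  by apply: gen_sub => // _ [[->|->]|->] //; exact: chor_u.2.
have sT := gen_is_subgroup [set chor R n; r; rho]; have [_ TM _] := sT.
have Tr j : gen [set chor R n; r; rho] (r ^+ j)%g.
  by apply: (subgroupX _ sT); apply: sub_gen; left; right.
move=> g /(symmetry_decomp n_ge3 chor_u)[i [h [-> Gh]]] hE.
apply: (TM _ _); first by apply: (subgroupX _ sT); apply: sub_gen; left; left.
case: hE => -[A [y hE]]; rewrite hE in Gh *.
  by have [j ->] := time_shift_power Gh.
have := GM Gh (GV Grho); rewrite sym_invE sym_mulE mulgV.
have -> : (Refl (toT y) * (Refl (toT y0))^-1)%g = Rot (toT (y - y0)) by rewrite toTD toTN.
move=> /time_shift_power[j jE].
have -> : ((A, s1 n, Refl (toT y)) = r ^+ j * rho)%g.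
  rewrite -jE sym_mulE mulgVK mul1g; congr (_, _, _).
  by congr Refl; rewrite -toTD subrK.
by apply: TM => //; apply: sub_gen; right.
Qed.

Lemma s1_sqr : (s1 n * s1 n = 1)%g.
Proof.
apply/permP => j; rewrite -[LHS]/(Sn_act (s1 n * s1 n)%g j) Sn_actM.
by rewrite /Sn_act !permE /= s1_funK.
Qed.

Section Reversing.
Variables (A0 : O2 R) (y0 : R).
Hypothesis Grho : G (A0, s1 n, Refl (toT y0)).

Lemma reversing_sqr : (A0 * A0 = 1)%g.
Proof.
have := GM Grho Grho; rewrite sym_mulE s1_sqr Refl_Refl subrr; exact: trivial_isotropy.
Qed.

Lemma reversing_neq1 : A0 <> 1%g.
Proof. by move=> A01; have := Grho; rewrite A01; exact: no_time_reversal. Qed.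

(** Time reversal inverts the shift by 1/k, so this product moves neither time nor bodies and its
    plane part is trivial. *)
Lemma reversing_inverts : (A0 * A1 * A0 * A1 = 1)%g.
Proof.
have := GM (GM (GM Grho Gr) Grho) Gr; rewrite !sym_mulE !mulg1 s1_sqr.
rewrite Refl_Rot Refl_Refl Rot_Rot.
have -> : y0 - k%:R^-1 - y0 + k%:R^-1 = 0 by rewrite addrAC subrK subrr.
exact: trivial_isotropy.
Qed.

(** A second time-reversing symmetry: its plane part is a rotation if [A0] and [A1] are both
    reflections, and the forbidden identity if both are half-turns. *)
Lemma reversing_shift : G ((A0 * A1)%g, s1 n, Refl (toT (y0 - k%:R^-1))).
Proof.
by have := GM Grho Gr; rewrite sym_mulE mulg1 Refl_Rot.
Qed.

End Reversing.

Lemma involution_reflection : (A1 * A1 = 1)%g -> A1 <> 1%g -> k = 2%N.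
Proof.
move=> AA A1n; have := @plane_part_order 2; rewrite expg2 => /(_ AA).
move/dvdn_leq => /(_ isT); have := plane_part_power.
by case: k k_gt0 => [//|[|[|//]]] _; rewrite ?expg1.
Qed.

Lemma plane_part_rotation a : A1 = plane_rot a -> exists l : nat,
  [/\ (1 <= l)%N, coprime k l & A1 = plane_rot (2 * pi * (l%:R / k%:R))].
Proof.
move=> Aa; have := plane_part_power; rewrite Aa -plane_rotX => /plane_rot_eq1[i ki].
have kz : (k : int) != 0 by rewrite eqz_nat -lt0n.
have [j ij] : exists j : nat, (i %% k)%Z = j.
  by have := modz_ge0 i kz; case: (i %% k)%Z => // j _; exists j.
(* Adding k to the residue does not change the rotation and keeps the numerator positive when the
   residue is 0. *)
have A1E : A1 = plane_rot (2 * pi * ((j + k)%N%:R / k%:R)).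
  rewrite Aa -(plane_rotDZ _ ((i %/ k)%Z - 1)); congr plane_rot.
  apply: (mulfI k0); rewrite ki {1}(divz_eq i k) ij !intrD intrM natrD -!pmulrn.
  by field.
rewrite -Aa; exists (j + k)%N; split=> //; first by rewrite addn_gt0 k_gt0 orbT.
rewrite /coprime; set d := gcdn _ _.
have d_gt0 : (0 < d)%N by rewrite gcdn_gt0 k_gt0.
have dk : (k %/ d * d = k)%N by rewrite divnK ?dvdn_gcdl.
have dl : ((j + k) %/ d * d = j + k)%N by rewrite divnK ?dvdn_gcdr.
(* A common divisor d would make the (k/d)-th power of [A1] trivial, while its order is k; hence d =
   1. *)
have : (k %| k %/ d)%N.
  apply: plane_part_order; rewrite A1E -plane_rotX.
  have -> : (k %/ d)%N%:R * (2 * pi * ((j + k)%N%:R / k%:R)) =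
            2 * pi * (0 + (((j + k) %/ d)%N : int)%:~R) :> R.
    have kE : k%:R = (k %/ d)%N%:R * d%:R :> R by rewrite -natrM dk.
    have lE : (j + k)%N%:R = ((j + k) %/ d)%N%:R * d%:R :> R by rewrite -natrM dl.
    rewrite kE lE add0r -pmulrn.
    have kd0 : (k %/ d)%N%:R != 0 :> R by rewrite pnatr_eq0 -lt0n divn_gt0 // dvdn_leq ?dvdn_gcdl.
    have d0 : d%:R != 0 :> R by rewrite pnatr_eq0 -lt0n.
    by rewrite -mulf_div divff // mulr1 mulrCA; congr (_ * _); rewrite mulrC divfK.
  by rewrite plane_rotDZ mulr0 plane_rot0.
move/dvdn_leq; rewrite divn_gt0 // dvdn_leq ?dvdn_gcdl // => /(_ isT).
by rewrite -{1}dk => h; apply/eqP; move: h; have := divn_gt0 k d_gt0;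
  rewrite dvdn_leq ?dvdn_gcdl //; nia.
Qed.

Lemma classification_C l : A1 = plane_rot (2 * pi * (l%:R / k%:R)) ->
  (forall A y, ~ G (A, s1 n, Refl (toT y))) -> conjugate G (C_group R n k l).
Proof. by move=> AE noR; rewrite (generated_rotations noR) /r AE;
  exact: conjugate_refl. Qed.

Lemma classification_D l a y0 : A1 = plane_rot (2 * pi * (l%:R / k%:R)) ->
  G (reflection a, s1 n, Refl (toT y0)) -> conjugate G (D_group R n k l).
Proof.
move=> AE Grho; rewrite (generated_reflections Grho) D_groupE /r AE.
(* Conjugation by [g] carries the real axis to the axis at angle [a] and the fixed time 0 of the
   reversal to y0 / 2; it leaves [chor] and [r] unchanged. *)
pose g : sym R n := (plane_rot (- a), 1%g, Rot (toT (- (y0 / 2)))).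
have cg : (chor R n ^ g)%g = chor R n by exact: chor_conj.
have rg x y : ((plane_rot x, 1%g, Rot (toT y)) ^ g)%g = (plane_rot x, 1%g, Rot (toT y)).
  by rewrite sym_conjE plane_rot_conj Rot_conj.
have kg : ((kappa R, s1 n, Refl (toT 0)) ^ g)%g = (reflection a, s1 n, Refl (toT y0)).
  by rewrite sym_conjE -reflectionE Refl_conj; congr (_, _, Refl (toT _)); field.
apply: (conjugate_gen (g := g)) => [_ [[->|->]|->]|_ [[->|->]|->]].
- by rewrite cg; apply: sub_gen; left; left.
- by rewrite rg; apply: sub_gen; left; right.
- by rewrite kg; apply: sub_gen; right.
- by rewrite (conjgVE cg); apply: sub_gen; left; left.
- by rewrite (conjgVE (rg _ _)); apply: sub_gen; left; right.
- by rewrite (conjgVE kg); apply: sub_gen; right.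
Qed.

Lemma classification_C'2 a : A1 = reflection a -> k = 2%N -> odd n ->
  (forall A y, ~ G (A, s1 n, Refl (toT y))) -> conjugate G (C'2_group R n).
Proof.
move=> AE k2 on noR; rewrite (generated_rotations noR) /C'2_group.
pose g : sym R n := (plane_rot (- a), 1%g, Rot (toT 0)).
have cg : (chor R n ^ g)%g = chor R n by exact: chor_conj.
(* Up to conjugacy the single generator of the model is a product of [chor] and [r]. Conversely,
   [chor] is its square and [r] is recovered by division. *)
have hg : (half_chor n (kappa R) ^ g = chor R n ^+ (n.+1)./2 * r)%g.
  by rewrite /half_chor sym_conjE -reflectionE Rot_conj -AE -/(half_chor n A1) half_chorE // /r k2.
set T := [set _; _]; set S := [set _].
have [_ TM _] := gen_is_subgroup T; have [_ SM SV] := gen_is_subgroup S.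
have Sc : gen S (chor R n).
  rewrite -(half_chor_sqr _ on (kappa_sqr R)) //.
  by apply: (subgroupX _ (gen_is_subgroup S)); exact: sub_gen.
apply: (conjugate_gen (g := g)) => [_ ->|_ [->|->]].
- rewrite -/(half_chor n (kappa R)) hg; apply: (TM _ _).
    by apply: (subgroupX _ (gen_is_subgroup T)); apply: sub_gen; left.
  by apply: sub_gen; right.
- by rewrite (conjgVE cg).
- have -> : r = ((chor R n ^+ (n.+1)./2)^-1 * half_chor n (kappa R) ^ g)%g by rewrite hg mulKg.
  rewrite conjMg conjgK conjVg conjXg (conjgVE cg); apply: (SM _ _).
    by apply: SV; exact: subgroupX (gen_is_subgroup S) Sc.
  exact: sub_gen.
Qed.

Lemma classification_D'1 y0 : k = 1%N ->
  G (plane_rot pi, s1 n, Refl (toT y0)) -> conjugate G (D'1_group R n).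
Proof.
move=> k1 Grho; rewrite (generated_reflections Grho) /D'1_group.
have r1 : r = 1%g.
  rewrite /r k1 invr1; have := plane_part_power; rewrite k1 expg1 => ->.
  by congr (_, _, Rot _); rewrite -toT0; apply/toT_eq; exists 1; rewrite subr0.
pose g : sym R n := (1%g, 1%g, Rot (toT (- (y0 / 2)))).
have cg : (chor R n ^ g)%g = chor R n by exact: chor_conj.
have kg : ((plane_rot pi, s1 n, Refl (toT 0)) ^ g)%g = (plane_rot pi, s1 n, Refl (toT y0)).
  by rewrite sym_conjE conjg1 Refl_conj; congr (_, _, Refl (toT _)); field.
apply: (conjugate_gen (g := g)) => [_ [->|->]|_ [[->|->]|->]].
- by rewrite cg; apply: sub_gen; left; left.
- by rewrite kg; apply: sub_gen; right.
- by rewrite (conjgVE cg); apply: sub_gen; left.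
- by rewrite r1 conj1g; have [] := gen_is_subgroup [set chor R n;
  (plane_rot pi, s1 n, Refl (toT 0))].
- by rewrite (conjgVE kg); apply: sub_gen; right.
Qed.

(** The half-turn commutes with rotations, so one [g] can turn the axis of [A1] onto the real line
    and independently centre the time reversal. *)
Lemma classification_D'2 a y0 : A1 = reflection a -> k = 2%N -> odd n ->
  G (plane_rot pi, s1 n, Refl (toT y0)) -> conjugate G (D'2_group R n).
Proof.
move=> AE k2 on Grho; rewrite (generated_reflections Grho) /D'2_group.
pose g : sym R n := (plane_rot (- a), 1%g, Rot (toT (- (y0 / 2)))).
have cg : (chor R n ^ g)%g = chor R n by exact: chor_conj.
have hg : (half_chor n (kappa R) ^ g = chor R n ^+ (n.+1)./2 * r)%g.
  by rewrite /half_chor sym_conjE -reflectionE Rot_conj -AE -/(half_chor n A1) half_chorE // /r k2.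
have kg : ((plane_rot pi, s1 n, Refl (toT 0)) ^ g)%g = (plane_rot pi, s1 n, Refl (toT y0)).
  by rewrite sym_conjE plane_rot_conj Refl_conj; congr (_, _, Refl (toT _)); field.
set T := [set _; _; _]; set S := [set _; _].
have [_ TM _] := gen_is_subgroup T; have [_ SM SV] := gen_is_subgroup S.
have Sc : gen S (chor R n).
  rewrite -(half_chor_sqr _ on (kappa_sqr R)) //.
  by apply: (subgroupX _ (gen_is_subgroup S)); apply: sub_gen; left.
apply: (conjugate_gen (g := g)) => [_ [->|->]|_ [[->|->]|->]].
- rewrite -/(half_chor n (kappa R)) hg; apply: (TM _ _).
    by apply: (subgroupX _ (gen_is_subgroup T)); apply: sub_gen; left; left.
  by apply: sub_gen; left; right.
- by rewrite kg; apply: sub_gen; right.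
- by rewrite (conjgVE cg).
- have -> : r = ((chor R n ^+ (n.+1)./2)^-1 * half_chor n (kappa R) ^ g)%g by rewrite hg mulKg.
  rewrite conjMg conjgK conjVg conjXg (conjgVE cg); apply: (SM _ _).
    by apply: SV; exact: subgroupX (gen_is_subgroup S) Sc.
  by apply: sub_gen; left.
- by rewrite (conjgVE kg); apply: sub_gen; right.
Qed.

(** If [A1] is a rotation, the group is of type C without time reversal, D if the reversing plane
    part is a reflection, and D'1 if it is a half-turn. If [A1] is a reflection, then k = 2 and n is
    odd, and the types are C'2 and D'2. *)
Lemma finite_times_classification :
  (exists k l : nat, [/\ (1 <= k)%N, (1 <= l)%N, coprime k l &
     conjugate G (C_group R n k l) \/ conjugate G (D_group R n k l)]) \/
  (odd n /\ [\/ conjugate G (C'2_group R n), conjugate G (D'1_group R n)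
              | conjugate G (D'2_group R n)]).
Proof.
have half_turn B z : G (B, s1 n, Refl (toT z)) -> (exists b, B = plane_rot b) -> B = plane_rot pi.
  move=> GB [b Bb]; rewrite Bb; apply: plane_rot_involution; rewrite -Bb.
    exact: (reversing_sqr GB).
  exact: (reversing_neq1 GB).
have [[a Aa]|[a Aa]] := O2P A1.
  have [l [l1 kl A1E]] := plane_part_rotation Aa.
  have [[A0 [y0 Grho]]|noR] := pselect (exists A y, G (A, s1 n, Refl (toT y))); last first.
    left; exists k, l; split=> //; left; apply: classification_C => // A y GA.
    by apply: noR; exists A, y.
  have [A0rot|[b Ab]] := O2P A0; last first.
    left; exists k, l; split=> //; right; apply: (classification_D (a := b) (y0 := y0) A1E).
    by rewrite /reflection -Ab.
  have A0pi := half_turn _ _ Grho A0rot; rewrite A0pi in Grho.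
  have A0sqr := reversing_sqr Grho.
  have on := reversing_half_turn_odd n_ge3 chor_u Grho.
  right; split=> //; apply: Or32; apply: (classification_D'1 _ Grho).
  (* The half-turn commutes with the rotation [A1], so inversion gives [A1] square 1. If [A1] were
     itself the half-turn, [A0 * A1] would be trivial and give a pure time reversal; hence [A1] is 1
     and k = 1. *)
  have [A11|A1n] := pselect (A1 = 1%g).
    by apply/eqP; rewrite -dvdn1; apply: plane_part_order; rewrite expg1.
  have AA : (A1 * A1 = 1)%g.
    have := reversing_inverts Grho; have := reversing_sqr Grho.
    by rewrite Aa -(mulgA (plane_rot pi)) plane_rotC !mulgA => ->; rewrite mul1g.
  have A1pi : A1 = plane_rot pi by rewrite Aa; apply: plane_rot_involution; rewrite -Aa.
  have := reversing_neq1 (reversing_shift Grho); rewrite A1pi; case.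
  exact: A0sqr.
have k2 : k = 2%N.
  by apply: involution_reflection; rewrite Aa;
    [exact: reflection_sqr|exact: reflection_neq1].
have on : odd n.
  apply: (half_period_reflection_odd n_ge3 chor_u (a := a)).
  by rewrite div1r /reflection -Aa -k2.
right; split=> //.
have [[A0 [y0 Grho]]|noR] := pselect (exists A y, G (A, s1 n, Refl (toT y))); last first.
  by apply: Or31; apply: (classification_C'2 Aa k2 on) => A y GA; apply: noR; exists A, y.
apply: Or33; have [A0rot|[b Ab]] := O2P A0.
  by have A0pi := half_turn _ _ Grho A0rot; rewrite A0pi in Grho;
    exact: (classification_D'2 Aa k2 on Grho).
(* The product of the two reflections is a rotation, so the shifted reversal has a half-turn as
   plane part. *)
have Gs := reversing_shift Grho.
have A01pi : (A0 * A1)%g = plane_rot pi.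
  apply: half_turn Gs _; rewrite Ab Aa -!/(reflection _) reflectionM; by eexists.
by rewrite A01pi in Gs; exact: (classification_D'2 Aa k2 on Gs).
Qed.

End FiniteTimes.

(** * Circular motions of arbitrary amplitude and phase *)

Section Circular.
Variables (R : realType) (n : nat).

(** Homotheties are not in [sym], so the radius cannot be absorbed by conjugation; it drops out
    because O(2) acts linearly. *)
Lemma scaling_symmetry (r : R) (v : loop R n) : r != 0 ->
  symmetry_group (fun t => r%:C *: v t) = symmetry_group v.
Proof.
move=> r0; have rC : r%:C != 0 by rewrite eq_complex /= negb_and r0.
have actZ A z : O2_act A (r%:C * z) = r%:C * O2_act A z.
  by case: z => x y; apply/eqP; rewrite eq_complex /=; apply/andP; split; apply/eqP; ring.
apply/seteqP; split=> -[[A s] tau] /symmetry_groupP H; apply/symmetry_groupP => t j.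
  by have := H t j; rewrite !mxE actZ; exact: mulfI.
by rewrite !mxE actZ H.
Qed.

Lemma polar_decomposition (c : R[i]) : c != 0 -> exists r a, r != 0 /\ c = r%:C * cis a.
Proof.
case: c => x y; rewrite eq_complex /= negb_and => xy.
have s_gt0 : 0 < x ^+ 2 + y ^+ 2.
  by rewrite lt_neqAle addr_ge0 ?sqr_ge0 // andbT eq_sym paddr_eq0 ?sqr_ge0 // !sqrf_eq0 negb_and.
pose r := Num.sqrt (x ^+ 2 + y ^+ 2).
have r0 : r != 0 by rewrite gt_eqF ?sqrtr_gt0.
have rr : r ^+ 2 = x ^+ 2 + y ^+ 2 by rewrite sqr_sqrtr // ltW.
have [a [xa ya] _] : exists2 a, x / r = cos a /\ y / r = sin a & `|a| <= pi.
  by apply: unit_circle_angle; rewrite !expr_div_n -mulrDl -rr divff // expf_neq0.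
exists r, a; split=> //; apply/eqP; rewrite eq_complex /= -xa -ya.
by apply/andP; split; apply/eqP; field.
Qed.

Lemma circular_classification (u : loop R n) : (3 <= n)%N -> choreography u -> is_circular u ->
  exists l : int, coprimez l (n : int) /\ conjugate (symmetry_group u) (Dinf_group R n l).
Proof.
move=> n_ge3 [[_ cu] _] [c [l uE]].
have n0 : n%:R != 0 :> R by rewrite pnatr_eq0; lia.
have coll := fun i j => (cu (toT 0)).2 i j.
have c0 : c != 0.
  apply/eqP => c0; have lt0n : (0 < n)%N by lia.
  have lt1n : (1 < n)%N by lia.
  have := coll (Ordinal lt0n) (Ordinal lt1n) isT.
  by rewrite uE c0 scale0r !mxE eqxx.
exists l; split.
  (* If d > 1 divides both l and n, the bodies with indices 0 and n/d coincide. *)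
  rewrite coprimezE /= /coprime; set d := gcdn _ _; apply: contraT => d1.
  have n_gt0 : (0 < n)%N by lia.
  have d_gt0 : (0 < d)%N by rewrite gcdn_gt0 n_gt0 orbT.
  have dn : (n %/ d * d = n)%N by rewrite divnK // dvdn_gcdr.
  have /dvdzP[q lq] : ((d : int) %| l)%Z by rewrite dvdzE dvdn_gcdl.
  have n'n : (n %/ d < n)%N by rewrite ltn_Pdiv //; lia.
  have n'0 : (0 < n %/ d)%N by rewrite divn_gt0 // dvdn_leq ?dvdn_gcdr.
  have nz : n%:R = (n %/ d)%N%:R * d%:R :> R by rewrite -natrM dn.
  have bodies : Ordinal n_gt0 != Ordinal n'n by rewrite -(inj_eq val_inj) /=; lia.
  have := coll _ _ bodies; rewrite uE.
  have Z (v : 'rV[R[i]]_n) j : (c *: v) 0 j = c * v 0 j by rewrite mxE.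
  rewrite !Z !circularE /= mulr0 mul0r.
  have -> : l%:~R * (n %/ d)%N%:R / n%:R = 0 + q%:~R :> R.
    by rewrite lq intrM -pmulrn -[q%:~R * d%:R * _]mulrA [d%:R * _]mulrC -nz mulfK // add0r.
  by rewrite cisDZ eqxx.
have [r [a [r0 cE]]] := polar_decomposition c0.
(* The real factor of the amplitude leaves the symmetry group unchanged, and its phase acts as a
   rotation of the plane, hence by conjugation. *)
pose g : sym R n := (plane_rot a, 1%g, 1%g).
have -> : u = (fun t => r%:C *: loop_act g (circular R n l) t).
  apply/funext => t; rewrite uE cE; apply/rowP => j.
  have Z b (v : 'rV[R[i]]_n) : (b *: v) 0 j = b * v 0 j by rewrite mxE.
  have gE v : loop_act g v t 0 j = cis a * v t 0 j.
    by rewrite [LHS]mxE plane_rotE !invg1 S1hat_act1 /Sn_act perm1.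
  by rewrite !Z gE mulrA.
rewrite scaling_symmetry //; exact: conjugate_loop_act.
Qed.

End Circular.

Theorem theorem2p3 (R : realType) (n : nat) (hn : (3 <= n)%N) (u : loop R n)
    (hu : choreography u)
    (hper : least_period_one u \/ is_circular u) :
  let G : set (sym R n) := symmetry_group u in
  (exists l : int, coprimez l (n : int) /\ conjugate G (Dinf_group R n l)) \/
  (exists k l : nat, [/\ (1 <= k)%N, (1 <= l)%N, coprime k l &
     conjugate G (C_group R n k l) \/ conjugate G (D_group R n k l)]) \/
  (odd n /\ [\/ conjugate G (C'2_group R n), conjugate G (D'1_group R n)
              | conjugate G (D'2_group R n)]).
Proof.
move=> G; case: hper => [per|circ]; last by left; exact: circular_classification.
case: n hn u hu per @G => // m hn u hu per G.
have times1 : [set x : R | exists A, G (A, 1%g, Rot (toT x))] 1.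
  exists 1%g; have -> : toT 1 = toT 0 :> circle R by apply/toT_eq; exists 1; rewrite subr0.
  by rewrite toT0; have [] := symmetry_group_subgroup u.
have [[k [k0 [A1 Gr] tk]]|dense] := additive_subgroup_dichotomy (times_subgroup u) times1.
  right; apply: (finite_times_classification hn hu per k0 Gr) => A x GA.
  by apply: tk; exists A.
by left; apply: circular_classification => //; exact: dense_times_circular dense.
Qed.
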